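(* Let $d\ge2$, $a\in(0,\pi/2)$ and $\varepsilon\in(0,1]$. Then there are constants $\tilde c>0$, depending on $a,d,\varepsilon$, and $\tilde\beta>0$, depending on $a,d$, such that for every $\gamma_s\in(0,\infty)$ the following holds: if $X$ is an isotropic Poisson process on $\mathbb{S}^d$ with intensity $\gamma_s$ and $Z_V$ is the typical cell of the spherical Poisson--Voronoi tessellation induced by $X$, then $$\mathbb{P}\left(\vartheta_{\mathsf p}(Z_V)\ge\varepsilon\mid r_{\mathsf p}(Z_V)\ge a\right)\le\tilde c\,\exp\left(-\tilde\beta\,\varepsilon^{\frac{d+1}{2}}\,\gamma_s\right).$$
   Context: $\mathbb{S}^d$ is the unit sphere in $\mathbb{R}^{d+1}$ ($d\ge2$) with geodesic distance $d_s$; $\sigma_d^\circ$ is its normalized (probability) spherical Lebesgue measure; $B_s(x,r)$ is the closed geodesic ball; $\mathsf p\in\mathbb{S}^d$ is a fixed point. A spherically convex body is the intersection of $\mathbb{S}^d$ with a closed convex cone in $\mathbb{R}^{d+1}$ that is not a linear subspace; $\overline{\mathcal{K}}^d_{\mathsf p}$ is the set of spherically convex bodies $K$ with $\mathsf p\in K\subset B_s(\mathsf p,\pi/2)$. For closed $K\ni\mathsf p$ put $r_{\mathsf p}(K)=\max\{r\ge0:B_s(\mathsf p,r)\subset K\}$, $R_{\mathsf p}(K)=\min\{r\ge0:K\subset B_s(\mathsf p,r)\}$; for $K\in\overline{\mathcal{K}}^d_{\mathsf p}$ put $\vartheta_{\mathsf p}(K)=R_{\mathsf p}(K)-r_{\mathsf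 p}(K)$. Convention: the event $\{\vartheta_{\mathsf p}(Z_V)\ge\varepsilon\}$ is understood as $\{Z_V\in\overline{\mathcal{K}}^d_{\mathsf p},\ \vartheta_{\mathsf p}(Z_V)\ge\varepsilon\}$. An isotropic Poisson process $X$ with intensity $\gamma_s$ is a Poisson process on $\mathbb{S}^d$ with intensity measure $\gamma_s\sigma_d^\circ$. For finite $A\subset\mathbb{S}^d$ and $x\in A$, the Voronoi cell is $C(x,A)=\{y\in\mathbb{S}^d:d_s(y,x)\le d_s(y,z)\text{ for all }z\in A\}$ (so $C(x,\{x\})=\mathbb{S}^d$). The typical cell $Z_V$ is a random closed set with distribution $$\mathbb{P}(Z_V\in\cdot)=\frac1{\gamma_s}\mathbb{E}\int_{\mathbb{S}^d}\int_{\mathrm{SO}(d+1)}\mathbf 1\{\varphi^{-1}C(x,X)\in\cdot\}\,\overline\kappa(x,d\varphi)\,X(dx),$$ where $\overline\kappa$ is any probability kernel from $\mathbb{S}^d$ to $\mathrm{SO}(d+1)$ such that $\overline\kappa(x,\cdot)$ is concentrated on $\{\varphi\in\mathrm{SO}(d+1):\varphi\mathsf p=x\}$ for almost every $x$ (the distribution does not depend on the choice of $\overline\kappa$). *)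

(* Defs.v *)
From HB Require Import structures.
From mathcomp Require Import all_boot all_order all_algebra finmap.
From mathcomp Require Import all_classical all_reals all_analysis.
Set Implicit Arguments.
Unset Strict Implicit.
Unset Printing Implicit Defensive.
Import Order.TTheory GRing.Theory Num.Theory.
Import numFieldTopology.Exports numFieldNormedType.Exports.
Local Open Scope classical_set_scope.
Local Open Scope ring_scope.

(* Points of R^n are row vectors, a matrix phi acts on them by x |-> x *m phi,
   and S^d is the subset [sphere d] of 'rV[R]_d.+1. The norm `|_| of the
   library on 'rV[R]_n is the max norm and is not used here; its topology is
   the usual one. *)

Notation borel T := (g_sigma_algebraType (@open T%type)).

Section sphere.
Context {R : realType}.

Definition dotp n (x y : 'rV[R]_n) : R := \sum_i x 0 i * y 0 i.

Definition sphere d : set 'rV[R]_d.+1 := [set x | dotp x x = 1].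

Definition geodist d (x y : 'rV[R]_d.+1) : R := acos (dotp x y).

Definition geoball d (x : 'rV[R]_d.+1) (r : R) : set 'rV[R]_d.+1 :=
  [set y | sphere y /\ geodist x y <= r].

Definition SO n : set 'M[R]_n := [set phi | phi *m phi^T = 1%:M /\ \det phi = 1].

(* Lebesgue measure of a Borel subset of R^n, as an iterated integral
   (Tonelli). *)
Fixpoint volume n : set 'rV[R]_n -> \bar R :=
  match n with
  | 0 => fun A => (\1_A 0)%:E
  | n'.+1 => fun A =>
      (\int[lebesgue_measure]_t
         volume [set v : 'rV[R]_n' | A (row_mx (t%:M : 'rV[R]_1) v)])%E
  end.

Definition cone_over d (A : set 'rV[R]_d.+1) : set 'rV[R]_d.+1 :=
  [set y | exists x t, [/\ A x, sphere x, 0 <= t <= 1 & y = t *: x]].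

(* Spherical Lebesgue measure of A is (d + 1) times the volume of
   { t x : x in A, 0 <= t <= 1 }; the factor cancels in the normalization. *)
Definition sigma_sphere d (A : set (borel 'rV[R]_d.+1)) : \bar R :=
  (fine (volume (cone_over A)) / fine (volume (cone_over (@sphere d))))%:E.

Definition closed_convex_cone n (C : set 'rV[R]_n) : Prop :=
  [/\ closed C, C 0,
      forall x y, C x -> C y -> C (x + y) &
      forall (t : R) x, 0 <= t -> C x -> C (t *: x)].

Definition spherically_convex_body d (K : set 'rV[R]_d.+1) : Prop :=
  exists C : set 'rV[R]_d.+1,
    [/\ closed_convex_cone C,
        ~ (exists V : {vspace 'rV[R]_d.+1}, C = [set v | v \in V]) &
        K = @sphere d `&` C].

Definition convex_bodies_at d (p : 'rV[R]_d.+1) : set (set 'rV[R]_d.+1) :=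
  [set K | [/\ spherically_convex_body K, K p & K `<=` geoball p (pi / 2)]].

(* The radii are restricted to [0, pi]: all balls of radius at least pi
   coincide with the sphere, so without the bound the maximum would not exist
   for K = S^d (and sup would return 0). Thus S^d has inradius pi. *)
Definition inradius d (p : 'rV[R]_d.+1) (K : set 'rV[R]_d.+1) : R :=
  sup [set r | 0 <= r <= pi /\ geoball p r `<=` K].

Definition circumradius d (p : 'rV[R]_d.+1) (K : set 'rV[R]_d.+1) : R :=
  inf [set r | 0 <= r /\ K `<=` geoball p r].

Definition vartheta d (p : 'rV[R]_d.+1) (K : set 'rV[R]_d.+1) : R :=
  circumradius p K - inradius p K.

Definition voronoi_cell d (x : 'rV[R]_d.+1) (A : set 'rV[R]_d.+1) :
    set 'rV[R]_d.+1 :=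
  [set y | sphere y /\ forall z, A z -> geodist y x <= geodist y z].

End sphere.

Section poisson_process.
Context {R : realType} (d : nat) {dO : measure_display} {O : measurableType dO}.
Variable P : probability O R.

Definition points_in (F : {fset 'rV[R]_d.+1}) (A : set 'rV[R]_d.+1) : nat :=
  #|` [fset x in F | x \in A]%fset|.

(* The intensity measure is finite and has no atoms, so the process is
   realized as a finite random set of points. The probability mass function is
   spelled out because [poisson_pmf 0 k] is 1 for every k in the library. *)
Definition isotropic_poisson_process (gamma : R)
    (X : O -> {fset 'rV[R]_d.+1}) : Prop :=
  [/\ forall w x, x \in X w -> sphere x,
      forall A : set (borel 'rV[R]_d.+1), measurable A ->
        measurable_fun setT (fun w => points_in (X w) A),
      forall (A : set (borel 'rV[R]_d.+1)) (k : nat), measurable A ->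
        let rate := gamma * fine (sigma_sphere A) in
        P [set w | points_in (X w) A = k] =
          (rate ^+ k / k`!%:R * expR (- rate))%:E &
      forall (m : nat) (A : 'I_m -> set (borel 'rV[R]_d.+1)) (k : 'I_m -> nat),
        (forall i, measurable (A i)) -> trivIset setT A ->
        P [set w | forall i, points_in (X w) (A i) = k i] =
          (\prod_(i < m) P [set w | points_in (X w) (A i) = k i])%E].

(* A probability kernel from S^d to SO(d + 1); its values outside S^d are
   irrelevant. *)
Definition rotation_kernel (p : 'rV[R]_d.+1)
    (kappa : R.-pker (borel 'rV[R]_d.+1) ~> (borel 'M[R]_d.+1)) : Prop :=
  (forall x, sphere x -> kappa x (~` @SO R d.+1) = 0%E) /\
  {ae @sigma_sphere R d, forall x,
     kappa x (~` [set phi | SO phi /\ p *m phi = x]) = 0%E}.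

(* The distribution of the typical cell Z_V: [typical_cell_law gamma X kappa E]
   is P(Z_V \in E). The rotated cell phi^-1 C(x, X) is written as a preimage. *)
Definition typical_cell_law (gamma : R) (X : O -> {fset 'rV[R]_d.+1})
    (kappa : R.-pker (borel 'rV[R]_d.+1) ~> (borel 'M[R]_d.+1))
    (E : set (set 'rV[R]_d.+1)) : \bar R :=
  (gamma^-1%:E * \int[P]_w \sum_(x <- X w) \int[kappa x]_(phi in @SO R d.+1)
     (\1_E (mulmxr phi @^-1` voronoi_cell x [set` X w]))%:E)%E.

End poisson_process.

Definition cond_prob {R : realType} {T : Type} (mu : set T -> \bar R)
    (A B : set T) : R := fine (mu (A `&` B)) / fine (mu B).

(* Main.v *)
(* If the typical cell, seen from its nucleus x, contains the ball of radius a and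
   a point at distance at least r = a + eps / 2 (and at most pi / 2) in direction u,
   then X has no other point in the ball B(x, 2a) nor in the ball through x of
   radius r centred in direction u. The second ball sticks out of the first one in
   a lens of measure at least of order eps^((d+1)/2): its width is of order eps
   and its angular extent of order sqrt eps. The event that the inradius is at least
   a only requires B(x, 2a) to be empty, which yields the exponential gain once u is
   restricted to finitely many directions.

   Since the constant may depend on eps, x is discretized as well: the sphere is cut
   into finitely many cells A_j of small diameter, and the independence of the
   counts in A_j and in a region disjoint from A_j replaces the Mecke formula. The
   numerator is at most the sum over j and u of nu(A_j) exp(- gamma nu(U_ju \ A_j)),
   the denominator at least the sum over j of nu(A_j) exp(- gamma nu(A_j u B_j)),
   with B_j slightly larger than B(x, 2a) and U_ju slightly smaller than the union
   of the two balls. All estimates of nu use only the translation invariance of the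
   volume: zones are thin because disjoint translates of their cones fit in a ball,
   and lenses are large because eps^(-(d+1)/2) translates, up to a constant, of a box
   in their cone cover a ball. *)
Require Import Defs.
From HB Require Import structures.
From mathcomp Require Import all_boot all_order all_algebra finmap.
From mathcomp Require Import all_classical all_reals all_analysis.
From mathcomp Require Import measurable_realfun.
From mathcomp Require Import ring lra.
Set Implicit Arguments.
Unset Strict Implicit.
Unset Printing Implicit Defensive.
Import Order.TTheory GRing.Theory Num.Theory.
Import numFieldTopology.Exports numFieldNormedType.Exports.
Local Open Scope classical_set_scope.
Local Open Scope ring_scope.

(** * Inner products and bisectors *)

Section dotp_theory.
Context {R : realType} {n : nat}.
Implicit Types (x y z : 'rV[R]_n) (t : R).

Lemma dotpE x y : dotp x y = (x *m y^T) 0 0.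
Proof. by rewrite mxE; apply: eq_bigr => i _; rewrite mxE. Qed.

Lemma dotpC x y : dotp x y = dotp y x.
Proof. by apply: eq_bigr => i _; rewrite mulrC. Qed.

Lemma dotpDl x y z : dotp (x + y) z = dotp x z + dotp y z.
Proof. by rewrite -big_split; apply: eq_bigr => i _; rewrite mxE mulrDl. Qed.

Lemma dotpZl t x y : dotp (t *: x) y = t * dotp x y.
Proof. by rewrite mulr_sumr; apply: eq_bigr => i _; rewrite mxE mulrA. Qed.

Lemma dotpNl x y : dotp (- x) y = - dotp x y.
Proof. by rewrite -scaleN1r dotpZl mulN1r. Qed.

Lemma dotpDr x y z : dotp x (y + z) = dotp x y + dotp x z.
Proof. by rewrite dotpC dotpDl !(dotpC x). Qed.

Lemma dotpZr t x y : dotp x (t *: y) = t * dotp x y.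
Proof. by rewrite dotpC dotpZl dotpC. Qed.

Lemma dotpNr x y : dotp x (- y) = - dotp x y.
Proof. by rewrite dotpC dotpNl dotpC. Qed.

Definition dotp_lin := (dotpDl, dotpDr, dotpNl, dotpNr, dotpZl, dotpZr).

Lemma dotp_ge0 x : 0 <= dotp x x.
Proof. by apply: sumr_ge0 => i _; rewrite -expr2 sqr_ge0. Qed.

Lemma dotp_eq0 x : dotp x x = 0 -> x = 0.
Proof.
move=> x0; apply/rowP => i; rewrite mxE; apply/eqP; rewrite -sqrf_eq0 expr2.
have /eqP := x0; rewrite psumr_eq0; last by move=> j _; rewrite -expr2 sqr_ge0.
by move=> /allP/(_ i); rewrite mem_index_enum => /(_ isT).
Qed.

Lemma dotp0l x : dotp 0 x = 0.
Proof. by rewrite -(scale0r x) dotpZl mul0r. Qed.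

Lemma CauchySchwarz x y : dotp x y ^+ 2 <= dotp x x * dotp y y.
Proof.
have [y0|y0] := eqVneq (dotp y y) 0.
  by rewrite (dotp_eq0 y0) dotpC !dotp0l mulr0 expr0n.
have yy : 0 < dotp y y by rewrite lt_def y0 dotp_ge0.
have := dotp_ge0 (dotp y y *: x - dotp x y *: y).
rewrite !dotp_lin (dotpC y x) => H.
rewrite -(ler_pM2l yy); move: H; lra.
Qed.

Definition enorm x : R := Num.sqrt (dotp x x).

Lemma enorm_ge0 x : 0 <= enorm x. Proof. exact: sqrtr_ge0. Qed.

Lemma sqr_enorm x : enorm x ^+ 2 = dotp x x.
Proof. by rewrite sqr_sqrtr// dotp_ge0. Qed.

Lemma enorm_eq0 x : enorm x = 0 -> x = 0.
Proof. by move=> x0; apply: dotp_eq0; rewrite -sqr_enorm x0 expr0n. Qed.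

Lemma normr_dotp_le x y : `|dotp x y| <= enorm x * enorm y.
Proof.
rewrite -ler_sqr ?nnegrE ?mulr_ge0 ?enorm_ge0//.
by rewrite real_normK ?num_real// exprMn !sqr_enorm CauchySchwarz.
Qed.

Lemma enormD x y : enorm (x + y) <= enorm x + enorm y.
Proof.
rewrite -ler_sqr ?nnegrE ?addr_ge0 ?enorm_ge0// sqrrD !sqr_enorm !dotp_lin
  (dotpC y x).
by have := le_trans (ler_norm _) (normr_dotp_le x y); lra.
Qed.

Lemma enormZ t x : enorm (t *: x) = `|t| * enorm x.
Proof.
by rewrite /enorm !dotp_lin mulrA -expr2 sqrtrM ?sqr_ge0// sqrtr_sqr.
Qed.

Lemma normr_coord_le x i : `|x 0 i| <= enorm x.
Proof.
rewrite -ler_sqr ?nnegrE ?enorm_ge0// sqr_enorm real_normK ?num_real//.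
rewrite /dotp (bigD1 i)//= -expr2 lerDl; apply: sumr_ge0 => j _.
by rewrite -expr2 sqr_ge0.
Qed.

Lemma enorm_le_sum x : enorm x <= \sum_i `|x 0 i|.
Proof.
rewrite -ler_sqr ?nnegrE ?enorm_ge0// ?sumr_ge0// sqr_enorm expr2 mulr_suml.
apply: ler_sum => i _; rewrite mulr_sumr (bigD1 i)//= -normrM -expr2.
rewrite ger0_norm ?sqr_ge0// lerDl; apply: sumr_ge0 => j _.
by rewrite mulr_ge0.
Qed.

Lemma dotp_orthogonal (phi : 'M[R]_n) x y : phi *m phi^T = 1%:M ->
  dotp (x *m phi) (y *m phi) = dotp x y.
Proof. by move=> o; rewrite !dotpE trmx_mul mulmxA -(mulmxA x) o mulmx1. Qed.

Lemma dotp_unit_bound x y : dotp x x = 1 -> dotp y y = 1 -> -1 <= dotp x y <= 1.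
Proof.
move=> x1 y1; rewrite -ler_norml; apply: le_trans (normr_dotp_le _ _) _.
by rewrite /enorm x1 y1 sqrtr1 mulr1.
Qed.

Lemma dotp_unit_inj x y : dotp x x = 1 -> dotp y y = 1 -> dotp x y = 1 -> x = y.
Proof.
move=> x1 y1 xy; apply/eqP; rewrite -subr_eq0; apply/eqP/dotp_eq0.
rewrite !dotp_lin (dotpC y x) x1 y1 xy; lra.
Qed.

(** With [c = cos a] this is the triangle inequality on the sphere: [z] is at distance at least
    [2 a] from [x], so points within [a] of [x] are no closer to [z]. The algebraic form is
    Cauchy-Schwarz for the components of [y] and [z] orthogonal to [x]. *)
Lemma dotp_le_of_cap x y z (c : R) :
  dotp x x = 1 -> dotp y y = 1 -> dotp z z = 1 -> 0 < c ->
  c <= dotp y x -> dotp x z <= 2 * c ^+ 2 - 1 -> dotp y z <= dotp y x.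
Proof.
move=> x1 y1 z1 c0 cyx xz.
have /andP[yx_lb yx_ub] := dotp_unit_bound y1 x1.
have /andP[xz_lb xz_ub] := dotp_unit_bound x1 z1.
set p := dotp y x in cyx yx_lb yx_ub *; set q := dotp x z in xz xz_lb xz_ub *.
have := CauchySchwarz (y - p *: x) (z - q *: x).
rewrite !dotp_lin x1 y1 z1 (dotpC x y) (dotpC z x) -/p -/q.
rewrite [X in X ^+ 2](_ : _ = dotp y z - p * q); last by ring.
rewrite [X in _ <= X](_ : _ = (1 - p ^+ 2) * (1 - q ^+ 2)); last by ring.
move=> H.
(* Once [1 - q] is factored out, what remains is [1 + q <= 2 * p ^+ 2]. *)
have H2 : (1 - p ^+ 2) * (1 - q ^+ 2) <= (p * (1 - q)) ^+ 2.
  have cp : c ^+ 2 <= p ^+ 2 by rewrite ler_sqr ?nnegrE ?(ltW c0) ?(le_trans _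
    cyx) ?(ltW c0).
  rewrite (_ : 1 - q ^+ 2 = (1 - q) * (1 + q)); last by ring.
  rewrite exprMn mulrCA expr2 mulrA [X in _ <= X]mulrC mulrAC.
  rewrite -subr_ge0 (_ : _ - _ = (1 - q) * (2 * p ^+ 2 - 1 - q)); last by ring.
  by rewrite mulr_ge0//; lra.
have B0 : 0 <= p * (1 - q).
  by rewrite mulr_ge0 ?subr_ge0//; exact: le_trans (ltW c0) cyx.
have := le_trans H H2; rewrite -real_normK ?num_real// ler_sqr ?nnegrE// => H3.
have := le_trans (ler_norm _) H3; lra.
Qed.

(** A converse to [dotp_le_of_cap]: the hypothesis is tested at the point of the geodesic from [x]
    to [z] whose angle to [x] has cosine [c] and sine [s]. *)
Lemma dotp_le_of_ball x z (c s : R) :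
  dotp x x = 1 -> dotp z z = 1 -> x != z -> 0 < c -> c ^+ 2 + s ^+ 2 = 1 ->
    0 <= s ->
  (forall y, dotp y y = 1 -> c <= dotp y x -> dotp y z <= dotp y x) ->
  dotp x z <= c ^+ 2 - s ^+ 2.
Proof.
move=> x1 z1 xz c0 cs s0 H.
have /andP[xz_lb xz_ub] := dotp_unit_bound x1 z1.
set q := dotp x z in xz_lb xz_ub *.
have q1 : q < 1.
  rewrite lt_neqAle xz_ub andbT; apply: contra xz => /eqP q1.
  by apply/eqP; exact: dotp_unit_inj.
(* For antipodal [z] no geodesic is distinguished, but the bound is trivial. *)
have [q_1|q_1] := eqVneq q (-1).
  by rewrite q_1; have := sqr_ge0 c; lra.
have q2 : 0 < 1 - q ^+ 2.
  rewrite (_ : 1 - q ^+ 2 = (1 - q) * (1 + q)); last by ring.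
  have q_2 : -1 < q by rewrite lt_def q_1.
  by rewrite mulr_gt0//; lra.
pose r := Num.sqrt (1 - q ^+ 2).
have r0 : 0 < r by rewrite sqrtr_gt0.
have r2 : r ^+ 2 = 1 - q ^+ 2 by rewrite sqr_sqrtr// ltW.
(* [z - q *: x] has length [r], so this is [x] turned towards [z]. *)
pose y := c *: x + (s / r) *: (z - q *: x).
have yx : dotp y x = c by rewrite !dotp_lin x1 (dotpC z x) -/q; ring.
have y1 : dotp y y = 1.
  rewrite !dotp_lin x1 z1 (dotpC z x) -/q.
  rewrite (_ : _ + _ = c ^+ 2 + (s / r) ^+ 2 * (1 - q ^+ 2)); last by ring.
  by rewrite -r2 -exprMn divfK ?gt_eqF.
have yz : dotp y z = c * q + s * r.
  rewrite !dotp_lin z1 -/q [LHS](_ : _ = c * q + (s / r) * (1 - q ^+ 2));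
    last by ring.
  by rewrite -r2 expr2 mulrA divfK ?gt_eqF.
have := H y y1; rewrite yx yz lexx => /(_ isT) H1.
have H2 : s * r <= c * (1 - q) by lra.
have H3 : s ^+ 2 * (1 - q ^+ 2) <= c ^+ 2 * (1 - q) ^+ 2.
  rewrite -r2 -!exprMn ler_sqr// nnegrE mulr_ge0// ?(ltW c0)// ?(ltW r0)//; lra.
have q3 : 0 < 1 - q by lra.
have : s ^+ 2 * (1 + q) <= c ^+ 2 * (1 - q).
  by rewrite -(ler_pM2l q3); move: H3; lra.
have : q * (c ^+ 2 + s ^+ 2) = q by rewrite cs mulr1.
lra.
Qed.

(* [u] is the direction in which [x] sees [y]; [dotp y z <= dotp y x] says that
   [z] is outside the open ball around [y] with [x] on its boundary. These balls
   grow with the distance of [y], so [y] may be replaced by the point at distance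
   [r] in the direction [u], where [C = cos r] and [S = sin r]. *)
Lemma direction_of_far_point x y (C S : R) :
  dotp x x = 1 -> dotp y y = 1 -> C ^+ 2 + S ^+ 2 = 1 -> 0 < S ->
  0 <= dotp y x -> dotp y x < C ->
  exists u, [/\ dotp u u = 1, dotp x u = 0 &
    forall z, dotp z z = 1 -> dotp y z <= dotp y x ->
      dotp u z <= C / S * (1 - dotp x z)].
Proof.
move=> x1 y1 CS S0; set c := dotp y x => c0 cC.
have cC2 : c ^+ 2 < C ^+ 2 by rewrite ltr_sqr// nnegrE ?(le_trans c0)// ltW.
have c2 : 0 < 1 - c ^+ 2 by have := sqr_ge0 S; lra.
pose s := Num.sqrt (1 - c ^+ 2).
have s0 : 0 < s by rewrite sqrtr_gt0.
have s2 : s ^+ 2 = 1 - c ^+ 2 by rewrite sqr_sqrtr// ltW.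
(* The unit tangent vector at [x] towards [y]. It gives the bound with the cotangent [c / s], which
   is at most [C / S]. *)
exists (s^-1 *: (y - c *: x)); split.
- rewrite !dotp_lin x1 y1 (dotpC x y) -/c.
  rewrite (_ : _ * _ = s^-1 ^+ 2 * (1 - c ^+ 2)); last by ring.
  by rewrite -s2 -exprMn mulVf ?gt_eqF// expr1n.
- by rewrite !dotp_lin x1 (dotpC x y) -/c; ring.
move=> z z1 yz; rewrite !dotp_lin.
have /andP[xz_lb xz_ub] := dotp_unit_bound x1 z1.
apply: (@le_trans _ _ (c / s * (1 - dotp x z))).
  rewrite [c / s]mulrC -mulrA ler_pM2l ?invr_gt0//; lra.
rewrite ler_wpM2r ?subr_ge0//.
have S2 : S <= s by rewrite -ler_sqr ?nnegrE ?ltW// s2; lra.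
apply: ler_pM => //; [by rewrite invr_ge0 ltW|exact: ltW|].
by rewrite lef_pV2.
Qed.

End dotp_theory.

(** * Volume is a translation-invariant Borel measure *)

Import HBNNSimple.

(* No measurability is needed: the integral of a nonnegative function is defined
   as the supremum of the integrals of the simple functions below it. *)
Lemma le_integral_nonneg d (T : measurableType d) (R : realType)
    (mu : {measure set T -> \bar R}) (D : set T) (f g : T -> \bar R) :
  (forall x, D x -> (0 <= f x)%E) -> (forall x, D x -> (f x <= g x)%E) ->
  (\int[mu]_(x in D) f x <= \int[mu]_(x in D) g x)%E.
Proof.
move=> f0 fg; rewrite !ge0_integralE//; last first.
  by move=> x Dx; rewrite (le_trans (f0 _ Dx))// fg.
apply: le_ereal_sup => _ [h hf <-]; exists h => // x;
  rewrite (le_trans (hf x))// /patch.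
by case: ifPn => // /set_mem; exact: fg.
Qed.

(** * Borel maps into spaces of row vectors *)

Section borel_measurability.
Context {R : realType}.

Lemma borel_open (T : ptopologicalType) (A : set (borel T)) :
  @open T A -> measurable A.
Proof. exact: sub_sigma_algebra. Qed.

Lemma borel_closed (T : ptopologicalType) (A : set (borel T)) :
  @closed T A -> measurable A.
Proof. by move=> cA; rewrite -[A]setCK; apply: measurableC; apply: borel_open;
  exact: closed_openC. Qed.

Lemma measurable_fun_borel d (T : measurableType d) (U : ptopologicalType)
    (f : T -> borel U) :
  (forall A, open (A : set U) -> measurable (f @^-1` A)) -> measurable_fun setT f.
Proof.
move=> fo; apply: (@measurability _ _ _ _ setT f (@open U)) => //.
by move=> _ [A oA <-]; rewrite setTI; exact: fo.
Qed.

(** Rational max-norm balls form a countable base whose members are products of intervals, so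
    measurability can be checked coordinatewise. *)
Lemma open_bigcup_ball n (A : set 'rV[R]_n) : open A ->
  A = \bigcup_(q : 'rV[rat]_n * nat) [set y |
    ball (map_mx ratr q.1 : 'rV[R]_n) q.2.+1%:R^-1 `<=` A /\
    ball (map_mx ratr q.1 : 'rV[R]_n) q.2.+1%:R^-1 y].
Proof.
move=> oA; rewrite eqEsubset; split => [y Ay|y [q _ [qA qy]]]; last exact: qA.
have /nbhs_ballP[e /= e0 eA] : nbhs y A by exact: open_nbhs_nbhs.
(* A radius below [e / 2] keeps a rational ball that contains [y] inside the ball of radius [e]
   around [y]. *)
pose k := Num.truncn (2 / e).
have ke : k.+1%:R^-1 < e / 2.
  rewrite invf_plt ?posrE ?divr_gt0// invf_div.
  have e2 : 0 < 2 / e by rewrite divr_gt0.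
  by have /andP[_] := truncn_itv (ltW e2).
have k0 : 0 < k.+1%:R^-1 :> R by rewrite invr_gt0.
have qP i : exists q : rat, ratr q \in `](y 0 i - k.+1%:R^-1),
  (y 0 i + k.+1%:R^-1)[.
  by apply: rat_in_itvoo; rewrite ltrBlDr -addrA ltrDl addr_gt0.
pose q := \row_i projT1 (cid (qP i)).
have qy i : `|ratr (q 0 i) - y 0 i| < k.+1%:R^-1.
  rewrite mxE; case: cid => r /=; rewrite in_itv/= => /andP[r1 r2].
  by rewrite ltr_norml ltrBrDl r1 /= ltrBlDl.
exists (q, k) => //=; split.
  move=> z [_ zq]; apply: eA; split => // i j; rewrite (ord1 i) /ball /= .
  have /= := zq 0 j; rewrite mxE /ball/= => zqj.
  rewrite (_ : y 0 j - z 0 j = (ratr (q 0 j) - z 0 j) - (ratr (q 0 j) - y 0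
    j)); last by ring.
  apply: le_lt_trans (ler_normB _ _) _.
  by rewrite [e]splitr ltrD// (lt_trans _ ke).
by split => // i j; rewrite (ord1 i) mxE /ball/=; exact: qy.
Qed.

Definition join_row n (tv : measurableTypeR R * borel 'rV[R]_n) :
  borel 'rV[R]_n.+1 := row_mx (tv.1%:M : 'rV[R]_1) tv.2.

Lemma join_row0 n (t : R) (v : 'rV[R]_n) : join_row (t, v) 0 0 = t.
Proof.
rewrite (_ : 0 = lshift n (0 : 'I_1)); last exact: val_inj.
by apply: etrans (row_mxEl _ _ _ _) _; rewrite mxE eqxx.
Qed.

Lemma join_rowS n (t : R) (v : 'rV[R]_n) j :
  join_row (t, v) 0 (lift ord0 j) = v 0 j.
Proof.
rewrite (_ : lift ord0 j = rshift 1 j); last exact: val_inj.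
exact: row_mxEr.
Qed.

(** A max-norm ball is the product of an interval and a ball in one dimension less. *)
Lemma measurable_join_row n : measurable_fun setT (@join_row n).
Proof.
apply: measurable_fun_borel => A oA;
  rewrite (open_bigcup_ball oA) preimage_bigcup.
apply: countable_bigcupT_measurable; first exact: countableP.
move=> [q k]; have [qA|qA] := pselect (ball (map_mx ratr q : 'rV[R]_n.+1)
  k.+1%:R^-1 `<=` A); last first.
  rewrite (_ : _ @^-1` _ = set0)//; apply/seteqP; split => // y /=.
  by move=> [].
rewrite (_ : _ @^-1` _ = (ball (ratr (q 0 0) : R) k.+1%:R^-1 : set
  (measurableTypeR R)) `*`
   (ball (\row_j ratr (q 0 (lift ord0 j)) : 'rV[R]_n) k.+1%:R^-1 : set (borel
     _))).
  by apply: measurableX; [rewrite ball_itv;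
    exact: measurable_itv|apply: borel_open; exact: ball_open].
apply/seteqP; split => [[t v] /= [_ [k0 H]]|[t v]/= [H1 [k0 H2]]].
  split; first by have := H 0 0; rewrite join_row0 !mxE.
  by split => // i j; have := H i (lift ord0 j); rewrite (ord1 i) join_rowS !mxE.
split => //; split => // i; rewrite (ord1 i) => j.
case: (unliftP ord0 j) => [j' ->|->]; last by rewrite join_row0 !mxE.
by rewrite join_rowS; have := H2 0 j'; rewrite !mxE.
Qed.

End borel_measurability.

Section volume_measure.
Context {R : realType}.

Lemma measurable_entry m n (i : 'I_m) (j : 'I_n) :
  measurable_fun setT (fun v : borel 'M[R]_(m, n) => (v i j : measurableTypeR R)).
Proof.
apply: (measurability _ (RGenOpens.measurableE R)).
move=> _ [_ [a [b ->] <-]]; rewrite setTI; apply: borel_open.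
apply: open_comp; first by move=> v _; exact: coord_continuous.
exact: interval_open.
Qed.

Lemma measurable_tail n :
  measurable_fun setT (fun v : borel 'rV[R]_n.+1 =>
    (\row_j v 0 (lift ord0 j) : borel 'rV[R]_n)).
Proof.
apply: measurable_fun_borel => A oA; apply: borel_open;
  apply: open_comp => // v _.
move=> B /nbhs_ballP[e /= e0 eB]; apply/nbhs_ballP; exists e => // w /= [_ vw].
by apply: eB; split => // i j; rewrite !mxE; exact: vw.
Qed.

Section join_measure.
Variables (n : nat) (m : {sigma_finite_measure set (borel 'rV[R]_n) -> \bar R}).

Definition join_measure (A : set (borel 'rV[R]_n.+1)) : \bar R :=
  ((@lebesgue_measure R) \x m)%E (@join_row R n @^-1` A).

Let join_measurable (A : set (borel 'rV[R]_n.+1)) :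
  measurable A -> measurable (@join_row R n @^-1` A).
Proof. by move=> mA; rewrite -[X in measurable X]setTI;
  exact: measurable_join_row. Qed.

Let join_measure0 : join_measure set0 = 0%E.
Proof. by rewrite /join_measure preimage_set0 measure0. Qed.

Let join_measure_ge0 A : (0 <= join_measure A)%E.
Proof. exact: measure_ge0. Qed.

Let join_measure_sigma_additive : semi_sigma_additive join_measure.
Proof.
move=> F mF tF mUF; rewrite /join_measure preimage_bigcup.
apply: measure_semi_sigma_additive.
- by move=> k; exact: join_measurable.
- apply/trivIsetP => /= i j _ _ ij; rewrite -preimage_setI.
  by move/trivIsetP : tF => /(_ _ _ _ _ ij) ->//; rewrite preimage_set0.
- by rewrite -preimage_bigcup; exact: join_measurable.
Qed.

HB.instance Definition _ := isMeasure.Build _ _ _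
  join_measure join_measure0 join_measure_ge0 join_measure_sigma_additive.

Let join_measure_sigma_finite : sigma_finite setT join_measure.
Proof.
have [F FT Ffin] := sigma_finiteT (@lebesgue_measure R).
have [G GT Gfin] := sigma_finiteT m.
pose FG k : set (borel 'rV[R]_n.+1) := if (choice.unpickle k : option (nat *
  nat)) is Some ij then [set v |
  F ij.1 (v 0 0) /\ G ij.2 (\row_j v 0 (lift ord0 j))] else set0.
exists FG => [|k].
  apply/seteqP; split => // v _.
  have [i _ Fi] : (\bigcup_i F i) (v 0 0) by rewrite -FT.
  have [j _ Gj] : (\bigcup_i G i) (\row_j v 0 (lift ord0 j)) by rewrite -GT.
  by exists (choice.pickle (i, j)) => //; rewrite /FG choice.pickleK.
rewrite /FG; case: (choice.unpickle k : option (nat * nat)) => [[i j]/=|];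
  last by rewrite measure0.
have [mF Ffi] := Ffin i; have [mG Gfi] := Gfin j; split.
  apply: measurableI; rewrite -[X in measurable X]setTI.
    exact: (measurable_entry 0 0).
  exact: measurable_tail.
rewrite /join_measure (_ : _ @^-1` _ = F i `*` G j).
  by rewrite product_measure1E// lte_mul_pinfty// ge0_fin_numE.
apply/seteqP; split => [[t v]|[t v]] /= []; rewrite join_row0.
  by move=> Ft; rewrite (_ : \row__ _ = v)//; apply/rowP => l;
    rewrite mxE join_rowS.
by move=> Ft; rewrite (_ : \row__ _ = v)//; apply/rowP => l;
  rewrite mxE join_rowS.
Qed.

HB.instance Definition _ := @Measure_isSigmaFinite.Build _ _ _
  join_measure join_measure_sigma_finite.

End join_measure.

(** Induction on [n]: the iterated integral that defines [volume] is the section integral of a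
    product measure, so [join_measure] is the next measure. Sigma-finiteness is carried along
    because forming the next product requires it. *)
Lemma volume_measureP n : exists mu : {sigma_finite_measure set (borel
  'rV[R]_n) -> \bar R},
  forall A : set (borel 'rV[R]_n), measurable A -> volume A = mu A.
Proof.
elim: n => [|n [mu muE]].
  by exists (@dirac _ (borel 'rV[R]_0) 0 R).
exists (join_measure mu) => A mA /=.
apply: eq_integral => t _ /=; rewrite -muE; first by congr volume;
  apply/seteqP; split => v; rewrite /xsection /= inE.
apply: measurable_xsection; rewrite -[X in measurable X]setTI.
exact: measurable_join_row.
Qed.

Definition volume_measure n := projT1 (cid (@volume_measureP n)).

Lemma volumeE n (A : set (borel 'rV[R]_n)) : measurable A ->
  volume A = @volume_measure n A.
Proof. exact: projT2 (cid (@volume_measureP n)) A. Qed.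

Lemma measurable_shift n (c : 'rV[R]_n) :
  measurable_fun setT ((+%R c) : borel 'rV[R]_n -> borel 'rV[R]_n).
Proof.
apply: measurable_fun_borel => A oA; apply: borel_open;
  apply: open_comp => // v _.
by apply: (@continuousD _ _ _ (cst c) id); [exact: cst_continuous|].
Qed.

(** By uniqueness of Lebesgue measure it suffices to compare half-open intervals. *)
Lemma lebesgue_measure_shift (c : R) (A : set (measurableTypeR R)) : measurable
  A ->
  lebesgue_measure (+%R c @^-1` A) = lebesgue_measure A.
Proof.
move=> mA; apply/esym.
have mc : measurable_fun setT (+%R c : measurableTypeR R -> measurableTypeR R).
  by apply: (@measurable_funD _ (measurableTypeR R) R setT (cst c) id).
apply: (@lebesgue_measure_unique R (pushforward lebesgue_measure (+%R c :
  measurableTypeR R -> measurableTypeR R))) => //= _ [[a b]] _ <-.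
rewrite /pushforward.
rewrite (_ : _ @^-1` _ = [set` `]a - c, b - c]]); last first.
  by apply/seteqP; split => x /=; rewrite !in_itv/= ltrBlDl lerBrDl.
rewrite !lebesgue_measure_itv/= !lte_fin ltrD2r.
by case: ifP => // _; rewrite -!EFinB; congr _%:E; ring.
Qed.

Lemma measurable_section n (A : set (borel 'rV[R]_n.+1)) t : measurable A ->
  measurable ([set v | A (row_mx (t%:M : 'rV[R]_1) v)] : set (borel 'rV[R]_n)).
Proof.
move=> mA; have mjA : measurable (@join_row R n @^-1` A).
  by rewrite -[X in measurable X]setTI; exact: measurable_join_row.
rewrite (_ : mkset _ = xsection (@join_row R n @^-1` A) t).
  exact: measurable_xsection.
by apply/seteqP; split => v; rewrite /xsection /= inE.
Qed.

Lemma measurable_volume_section n (A : set (borel 'rV[R]_n.+1)) : measurable A ->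
  measurable_fun setT (fun t : measurableTypeR R =>
    volume [set v : 'rV[R]_n | A (row_mx (t%:M : 'rV[R]_1) v)]).
Proof.
move=> mA; have mjA : measurable (@join_row R n @^-1` A).
  by rewrite -[X in measurable X]setTI; exact: measurable_join_row.
rewrite (_ : (fun _ => _) = @volume_measure n \o xsection (@join_row R n @^-1`
  A)).
  exact: measurable_fun_xsection.
apply/funext => t /=; rewrite volumeE; last exact: measurable_section.
congr (_ _); by apply/seteqP; split => v; rewrite /xsection /= inE.
Qed.

Lemma volume_ge0 n (A : set (borel 'rV[R]_n)) : measurable A -> (0 <= volume A)%E.
Proof. by move=> mA; rewrite volumeE. Qed.

(** Induction on [n]: the sections are translated by the tail of [c], the outer integral by its
    first coordinate. *)
Lemma volume_shift n (c : 'rV[R]_n) (A : set (borel 'rV[R]_n)) :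
  measurable A -> volume (+%R c @^-1` A) = volume A.
Proof.
elim: n c A => [|n IH] c A mA.
  rewrite /volume !indicE; congr (_%:R %:E); congr nat_of_bool.
  by apply/idP/idP; rewrite !inE /= (thinmx0 (c + 0)).
pose c0 : R := c 0 0.
pose g (t : measurableTypeR R) : \bar R := volume [set v : 'rV[R]_n | A (row_mx
  (t%:M : 'rV[R]_1) v)].
have mg : measurable_fun setT g by exact: measurable_volume_section.
have mc : measurable_fun setT (+%R (c0) : measurableTypeR R -> measurableTypeR R).
  by apply: (@measurable_funD _ (measurableTypeR R) R setT (cst (c0)) id).
transitivity (\int[lebesgue_measure]_t g (c0 + t)%R)%E.
  apply: eq_integral => t _.
  have := IH (\row_j c 0 (lift ord0 j)) _ (measurable_section (c0 + t) mA).
  rewrite /g => <-; congr volume; apply/seteqP.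
  have E (v : 'rV[R]_n) : c + join_row (t, v) =
      join_row (c0 + t, \row_j c 0 (lift ord0 j) + v).
    apply/rowP => j; rewrite mxE; case: (unliftP ord0 j) => [j' ->|->].
      by rewrite !join_rowS !mxE.
    by rewrite !join_row0.
  by split => v /=; rewrite -/(join_row (t, v)) -/(join_row (c0 + t, _ + v)) E.
have g0 t : (0 <= g t)%E by apply: volume_ge0; exact: measurable_section.
transitivity (\int[pushforward lebesgue_measure (+%R (c0) : measurableTypeR R
  -> measurableTypeR R)]_t g t)%E.
  by rewrite (ge0_integral_pushforward mc).
by apply: eq_measure_integral => B mB _; exact: lebesgue_measure_shift.
Qed.

Definition cube n (a b : R) : set 'rV[R]_n := [set v | forall i, a <= v 0 i <= b].

Lemma measurable_cube n a b : measurable (@cube n a b : set (borel _)).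
Proof.
rewrite (_ : @cube n a b = \bigcap_(i : 'I_n) [set v : borel 'rV[R]_n | v 0 i
  \in `[a, b]]).
  apply: (@fin_bigcap_measurable _ (borel 'rV[R]_n)) => [|i _];
    first exact: finite_finset.
  rewrite -[X in measurable X]setTI.
  by have := measurable_entry (0 : 'I_1) i measurableT (measurable_itv `[a, b]).
apply/seteqP; split => v /= H i; first by move=> _ /=; rewrite in_itv/=; exact: H.
by have := H i I; rewrite /= in_itv.
Qed.

Lemma volume_cube n a b : a <= b -> volume (@cube n a b) = ((b - a) ^+ n)%:E.
Proof.
move=> ab; elim: n => [|n IH]; first by rewrite /= indicE mem_set// => -[].
transitivity (\int[lebesgue_measure]_(t in [set: measurableTypeR R])
    (((b - a) ^+ n)%R%:E * (\1_(`[a, b]%classic : set (measurableTypeR R))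
      t)%:E))%E; last first.
  rewrite ge0_integralZl//=; last 2 first.
  - exact/measurable_EFinP.
  - by rewrite lee_fin exprn_ge0// subr_ge0.
  rewrite integral_indic// setIT /= lebesgue_measure_itv/= lte_fin.
  case: ltP => [_|ba]; first by rewrite -EFinB -EFinM exprSr.
  have -> : a = b by apply/eqP; rewrite eq_le ab.
  by rewrite mule0 subrr expr0n.
apply: eq_integral => t _; rewrite indicE; have [tab|tab] := boolP (t \in _);
  rewrite /= ?mule1 ?mule0.
  rewrite -IH; congr volume; apply/seteqP; split => v /= H i.
    by have := H (lift ord0 i); rewrite -/(join_row (t, v)) join_rowS.
  rewrite -/(join_row (t, v)); case: (unliftP ord0 i) => [j ->|->].
    by rewrite join_rowS; exact: H.
  by rewrite join_row0; have := set_mem tab; rewrite /= in_itv.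
rewrite (_ : mkset _ = set0); first by rewrite -[LHS]/(volume set0) volumeE.
apply/seteqP; split => // v /= /(_ 0); rewrite -/(join_row (t, v)) join_row0 => H.
by move/negP: tab; apply; rewrite inE/= in_itv.
Qed.

End volume_measure.

(** * Cones *)

Section cones.
Context {R : realType}.

Lemma measurable_fun_row d (T : measurableType d) n (f : T -> borel 'rV[R]_n) :
  (forall i, measurable_fun setT (fun t => (f t 0 i : measurableTypeR R))) ->
  measurable_fun setT f.
Proof.
move=> mf; apply: measurable_fun_borel => A oA.
rewrite (open_bigcup_ball oA) preimage_bigcup.
apply: countable_bigcupT_measurable; first exact: countableP.
move=> [q k]; have [qA|qA] := pselect (ball (map_mx ratr q : 'rV[R]_n)
  k.+1%:R^-1 `<=` A); last first.
  by rewrite (_ : _ @^-1` _ = set0)//; apply/seteqP; split => // y /= [].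
rewrite (_ : _ @^-1` _ = \bigcap_(i : 'I_n)
    ((fun t => (f t 0 i : measurableTypeR R)) @^-1` ball (ratr (q 0 i) : R)
      k.+1%:R^-1)).
  apply: (@fin_bigcap_measurable _ T) => [|i _]; first exact: finite_finset.
  rewrite -[X in measurable X]setTI; apply: mf => //.
  by rewrite ball_itv; exact: measurable_itv.
apply/seteqP; split => t /=.
  by move=> [_ [_ H]] i _ /=; have := H 0 i; rewrite mxE.
move=> H; split => //; split => // i j; rewrite (ord1 i) mxE.
exact: H.
Qed.

Lemma measurable_dotp d (T : measurableType d) n (f g : T -> borel 'rV[R]_n) :
  measurable_fun setT f -> measurable_fun setT g ->
  measurable_fun setT (fun t => dotp (f t) (g t)).
Proof.
move=> mf mg; apply: measurable_sum => i; apply: measurable_funM.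
  exact: (measurableT_comp (measurable_entry 0 i) mf).
exact: (measurableT_comp (measurable_entry 0 i) mg).
Qed.

Lemma measurable_enorm n : measurable_fun setT (@enorm R n : borel 'rV[R]_n -> R).
Proof.
rewrite (_ : @enorm R n = (fun t => t `^ (2^-1)) \o (fun v => dotp v v));
  last first.
  by apply/funext => v /=; rewrite powR12_sqrt// dotp_ge0.
by apply: measurableT_comp; [exact: measurable_powR|exact: measurable_dotp].
Qed.

(** The origin is sent to itself, since [0^-1 = 0]. *)
Definition normalize n (v : 'rV[R]_n) : 'rV[R]_n := (enorm v)^-1 *: v.

Lemma measurable_normalize n :
  measurable_fun setT (@normalize n : borel 'rV[R]_n -> borel 'rV[R]_n).
Proof.
apply: measurable_fun_row => i.
rewrite (_ : (fun _ => _) = fun v : borel 'rV[R]_n => enorm v `^ (-1) * v 0 i);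
  last first.
  by apply/funext => v; rewrite mxE powR_inv1// enorm_ge0.
have mp : measurable_fun setT (fun v : borel 'rV[R]_n => enorm v `^ (-1)).
  exact: (measurableT_comp (measurable_powR (-1)) (@measurable_enorm n)).
exact: (measurable_funM mp (measurable_entry 0 i)).
Qed.

Lemma enorm_normalize n (v : 'rV[R]_n) : v != 0 -> enorm (normalize v) = 1.
Proof.
move=> v0; rewrite enormZ ger0_norm ?invr_ge0 ?enorm_ge0// mulVf//.
by apply: contra v0 => /eqP/enorm_eq0/eqP.
Qed.

(* [cone_over A] without its apex: a preimage under [normalize], hence Borel
   when [A] is, and additive in [A]. *)
Definition pcone n (A : set 'rV[R]_n) : set 'rV[R]_n :=
  [set v | 0 < enorm v <= 1 /\ A (normalize v)].

Lemma measurable_pcone n (A : set (borel 'rV[R]_n)) :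
  measurable A -> measurable (pcone A : set (borel 'rV[R]_n)).
Proof.
move=> mA; apply: measurableI; rewrite -[X in measurable X]setTI.
  rewrite setTI (_ : (fun v => _) = (@enorm R n : borel 'rV[R]_n ->
    R) @^-1` `]0, 1]).
    by rewrite -[X in measurable X]setTI; exact: measurable_enorm.
  by apply/seteqP; split => v /=; rewrite in_itv.
exact: measurable_normalize.
Qed.

Lemma sphereE d (x : 'rV[R]_d.+1) : sphere x = (enorm x = 1).
Proof.
rewrite /sphere /=; apply/propext; split => [x1|x1].
  by rewrite /enorm x1 sqrtr1.
by rewrite -sqr_enorm x1 expr1n.
Qed.

Lemma cone_overE d (A : set 'rV[R]_d.+1) :
  cone_over A `\ 0 = pcone A.
Proof.
apply/seteqP; split => [v [[x [t [Ax Sx /andP[t0 t1] vE]]] v0]|v [/andP[v0 v1]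
  Av]].
  have x1 : enorm x = 1 by rewrite -sphereE.
  have tp : 0 < t.
    rewrite lt_def t0 andbT; apply: contra_notN v0 => /eqP t00.
    by rewrite vE t00 scale0r.
  have vt : enorm v = t by rewrite vE enormZ x1 mulr1 ger0_norm.
  rewrite /pcone /= vt tp t1; split => //.
  by rewrite /normalize vt vE scalerA mulVf ?gt_eqF// scale1r.
split; last by move=> /= v00; move: v0; rewrite v00 /enorm dotp0l sqrtr0 ltxx.
exists (normalize v), (enorm v); split => //.
- rewrite sphereE enorm_normalize//; apply: contraTneq v0 => ->.
  by rewrite /enorm dotp0l sqrtr0 ltxx.
- by rewrite (ltW v0).
by rewrite scalerA mulfV ?scale1r// gt_eqF.
Qed.

Lemma measurable_set1_row n (v : 'rV[R]_n) : measurable ([set v] : set (borel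
  'rV[R]_n)).
Proof. by apply: borel_closed;
  exact: (accessible_closed_set1 (hausdorff_accessible (@norm_hausdorff _ _))).
  Qed.

Lemma volume_set10 n : volume [set (0 : 'rV[R]_n.+1)] = 0%E.
Proof.
rewrite (_ : [set 0] = @cube R n.+1 0 0);
  first by rewrite volume_cube// subrr expr0n.
apply/seteqP; split => v /=; first by move=> -> i; rewrite mxE lexx.
by move=> H; apply/rowP => i; rewrite mxE; apply/eqP; rewrite eq_le andbC;
  exact: H.
Qed.

(** The two sets differ at most by the apex, which is a null set. *)
Lemma volume_cone_over d (A : set (borel 'rV[R]_d.+1)) : measurable A ->
  volume (cone_over A) = volume_measure d.+1 (pcone A).
Proof.
move=> mA; have mpA := measurable_pcone mA.
have m0 := measurable_set1_row (0 : 'rV[R]_d.+1).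
have [c0|c0] := pselect (cone_over A 0).
  have E : cone_over A = (pcone A : set (borel 'rV[R]_d.+1)) `|` [set 0] by
    rewrite -cone_overE setDKU// => _ ->.
  rewrite E volumeE; last exact: measurableU.
  rewrite measureU//; last by rewrite -cone_overE setDKI.
  by rewrite [X in (_ + X)%E](_ : _ = 0%E) ?adde0//= -volumeE// volume_set10.
rewrite volumeE; first by congr (_ _); rewrite -cone_overE not_setD1.
by rewrite -(_ : pcone A = cone_over A)// -cone_overE not_setD1.
Qed.

End cones.

(** * Volume estimates by translation *)

Section packing_covering.
Context {R : realType} {n : nat}.
Implicit Types (A B : set (borel 'rV[R]_n)) (c : nat -> 'rV[R]_n).

Let measurable_translate (c : 'rV[R]_n) A :
  measurable A -> measurable (+%R c @^-1` A : set (borel 'rV[R]_n)).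
Proof. by move=> mA; rewrite -[X in measurable X]setTI;
  exact: measurable_shift. Qed.

Lemma le_volume A B : measurable A -> measurable B -> A `<=` B ->
  (volume A <= volume B)%E.
Proof. by move=> mA mB AB; rewrite !volumeE// le_measure ?inE. Qed.

(** Additivity and translation invariance: [m] disjoint copies of [A] share the volume of one cube
    of side 4. *)
Lemma volume_packing A c m : measurable A ->
  (forall k v, (k < m)%N -> A (c k + v) -> cube (-2) 2 v) ->
  (forall k l v, (k < l < m)%N -> A (c k + v) -> ~ A (c l + v)) ->
  (m%:R%:E * volume A <= (4 ^+ n)%:E)%E.
Proof.
move=> mA Acube Adisj.
pose F k : set (borel 'rV[R]_n) := if (k < m)%N then +%R (c k) @^-1` A else set0.
have mF k : measurable (F k).
  by rewrite /F; case: ifP => // _; exact: measurable_translate.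
have tF : trivIset setT F.
  apply/trivIsetP => k l _ _; wlog kl : k l / (k < l)%N.
    move=> H; rewrite neq_ltn => /orP[|] kl; first by apply: H;
      rewrite // ltn_eqF.
    by rewrite setIC; apply: H; rewrite // ltn_eqF.
  move=> _; rewrite /F; case: ifP => [km|]; last by rewrite set0I.
  case: ifP => [lm|]; last by rewrite setI0.
  by apply/seteqP; split => // v /= [] /Adisj; apply; rewrite kl.
have mU : measurable (\big[setU/set0]_(k < m) F k) by exact: bigsetU_measurable.
have E : volume (\big[setU/set0]_(k < m) F k) = (m%:R%:E * volume A)%E.
  rewrite volumeE//; apply: etrans (measure_semi_additive F m mF tF mU) _.
  rewrite (eq_bigr (fun=> volume A));
    first by rewrite sumr_const card_ord mule_natl.
  move=> k _; rewrite /F ltn_ord -(volume_shift (c k) mA).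
  by apply/esym/volumeE; exact: measurable_translate.
rewrite -E [X in (_ <= X)%E](_ : _ = volume (@cube R n (-2) 2)).
  apply: le_volume => //; first exact: measurable_cube.
  rewrite -bigcup_mkord => v [k /= km]; rewrite /F km /=; exact: Acube.
by rewrite volume_cube; [congr (_ ^+ _)%:E; lra|lra].
Qed.

Lemma volume_covering A B c m : measurable A -> measurable B ->
  (forall v, B v -> exists2 k, (k < m)%N & A (c k + v)) ->
  (volume B <= m%:R%:E * volume A)%E.
Proof.
move=> mA mB cover.
rewrite [leLHS]volumeE//.
have := @content_subadditive _ _ _ (volume_measure n) B (fun k =>
  +%R (c k) @^-1` A) m.
have H : B `<=` \big[setU/set0]_(k < m) (+%R (c k) @^-1` A).
  by rewrite -(bigcup_mkord m (fun k => +%R (c k) @^-1` A)) =>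
    v /cover[k km kv]; exists k.
move=> /(_ (fun k _ => measurable_translate (c k) mA) mB H) => /le_trans; apply.
rewrite (eq_bigr (fun=> volume A)); last first.
  move=> k _; rewrite -(volume_shift (c k) mA).
  by apply/esym/volumeE; exact: measurable_translate.
by rewrite sumr_const card_ord mule_natl.
Qed.

End packing_covering.

Section band.
Context {R : realType} {n : nat}.
Variables (x : 'rV[R]_n) (tau : R).
Hypothesis x1 : dotp x x = 1.

Let f (v : 'rV[R]_n) := dotp x v - tau * enorm v.

(** The inner product gains [s], while the norm changes by at most [s]. *)
Let f_increasing v (s : R) : 0 <= s -> (1 - `|tau|) * s + f v <= f (s *: x + v).
Proof.
move=> s0; rewrite /f !dotp_lin x1 mulr1.
have ex : enorm x = 1 by rewrite /enorm x1 sqrtr1.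
have H : `|enorm (s *: x + v) - enorm v| <= s.
  rewrite ler_norml; apply/andP; split.
    have := enormD (s *: x + v) ((- s) *: x).
    rewrite enormZ ex mulr1 normrN ger0_norm//.
    rewrite (_ : s *: x + v + _ = v); first by lra.
    by rewrite scaleNr addrAC subrr add0r.
  by have := enormD (s *: x) v; rewrite enormZ ex mulr1 ger0_norm//; lra.
have : tau * (enorm (s *: x + v) - enorm v) <= `|tau| * s.
  by apply: le_trans (ler_norm _) _; rewrite normrM ler_wpM2l.
lra.
Qed.

Lemma measurable_band (delta : R) : measurable
  ([set v | enorm v <= 1 /\ `|dotp x v - tau * enorm v| <= delta] : set (borel
    'rV[R]_n)).
Proof.
have mf : measurable_fun setT (f : borel 'rV[R]_n -> R).
apply: (@measurable_funB _ (borel 'rV[R]_n) R setT (fun v => dotp x v) (fun v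
  => tau * enorm v)).
  exact: (measurable_dotp (measurable_cst (x : borel 'rV[R]_n)) (@measurable_id
    _ (borel 'rV[R]_n) setT)).
exact: (measurable_funM (measurable_cst tau) (@measurable_enorm R n)).
apply: measurableI; rewrite -[X in measurable X]setTI.
  rewrite (_ : (fun v => _) = (@enorm R n : borel 'rV[R]_n -> R) @^-1` `]-oo, 1]).
    exact: measurable_enorm.
  by apply/seteqP; split => v /=; rewrite in_itv.
rewrite (_ : (fun v => _) = (f : borel 'rV[R]_n -> R) @^-1` `[- delta, delta]).
  exact: mf measurableT _ (measurable_itv `[- delta, delta]).
by apply/seteqP; split => v /=; rewrite in_itv/= ler_norml.
Qed.

(* [f] increases at rate at least [1 - |tau|] along [x], so the translates of the
   band by the multiples of [s *: x] are pairwise disjoint. *)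
Lemma volume_band (delta : R) : 0 < delta -> delta <= (1 - `|tau|) / 3 ->
  (volume [set v : 'rV[R]_n | (enorm v <= 1 /\ `|dotp x v - tau * enorm v| <=
    delta)%R] <=
   (4 ^+ n * (3 * delta / (1 - `|tau|)))%:E)%E.
Proof.
move=> d0 dtau; have t0 : 0 < 1 - `|tau| by lra.
set A := [set v | _].
have mA : measurable (A : set (borel 'rV[R]_n)) by exact: measurable_band.
(* A shift by [s *: x] raises [f] by at least [3 * delta], more than the width [2 * delta] of the
   band. *)
pose s := 3 * delta / (1 - `|tau|).
have s0 : 0 < s by rewrite divr_gt0// mulr_gt0.
have s1 : s <= 1 by rewrite ler_pdivrMr// mul1r; lra.
have ex : enorm x = 1 by rewrite /enorm x1 sqrtr1.
(* As many shifts as possible with total displacement at most 1, so that the translates stay in the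
   cube of [volume_packing]. *)
pose m := Num.truncn s^-1.
have /andP[m1 m2] : m%:R <= s^-1 < m.+1%:R by rewrite truncn_itv// invr_ge0 ltW.
have km k : (k < m.+1)%N -> 0 <= k%:R * s <= 1.
  rewrite ltnS => km; rewrite mulr_ge0 ?(ltW s0)//=.
  rewrite -[leRHS](@mulVf _ s) ?gt_eqF// ler_pM2r//.
  by apply: le_trans m1; rewrite ler_nat.
pose c (k : nat) := - (k%:R * s) *: x.
have := @volume_packing _ _ A c m.+1 mA.
rewrite -/s => H.
have {}H : (m.+1%:R%:E * volume A <= (4 ^+ n)%:E)%E.
  apply: H => [k v /km/andP[k0 k1] [Av _] i|k l v /andP[kl lm] [_ Ak] [_ Al]].
    rewrite -ler_norml (le_trans (normr_coord_le _ _))//.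
    rewrite (_ : v = (c k + v) + (k%:R * s) *: x); last first.
      by rewrite /c addrAC -scalerDl addNr scale0r add0r.
    apply: le_trans (enormD _ _) _; rewrite enormZ ex mulr1 ger0_norm//; lra.
  have kls : (0 : R) < (l - k)%:R by rewrite ltr0n subn_gt0.
  have := @f_increasing (c l + v) ((l - k)%:R * s).
  rewrite (_ : _ *: x + _ = c k + v); last first.
    rewrite /c addrA -scalerDl natrB 1?ltnW//; congr (_ *: _ + _); ring.
  rewrite mulr_ge0 ?(ltW kls) ?(ltW s0)// => /(_ isT).
  have : 3 * delta <= (1 - `|tau|) * ((l - k)%:R * s).
    rewrite mulrCA /s [_ * (_ / _)]mulrC divfK ?gt_eqF//.
    by rewrite ler_peMl ?mulr_ge0 ?(ltW d0)// ler1n subn_gt0.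
  by move: Ak Al; rewrite -/(f (c k + v)) -/(f (c l + v)) !ler_norml =>
    /andP[? ?] /andP[? ?]; lra.
have Vfin : volume A \is a fin_num.
  rewrite ge0_fin_numE ?volume_ge0//; rewrite ltey; apply/negP => /eqP Vy.
  by move: H; rewrite Vy gt0_muley ?lte_fin// leye_eq.
move: H; rewrite -(fineK Vfin) -EFinM !lee_fin => H.
have V0 : 0 <= fine (volume A) by rewrite fine_ge0// volume_ge0.
rewrite -/s -ler_pdivrMr//; apply: le_trans H.
by rewrite mulrC ler_wpM2r// ltW.
Qed.

End band.

(** * Boxes in general position *)

Section frame_box.
Context {R : realType} {n : nat}.
Variable G : 'M[R]_n.
Hypothesis GO : G *m G^T = 1%:M.

(** The [l i] are half-lengths along the columns of [G]; indexing them by [nat] makes it easy to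
    change one side at a time. *)
Definition frame_box (l : nat -> R) : set 'rV[R]_n :=
  [set v | forall i : 'I_n, `|(v *m G) 0 i| <= l i].

Lemma measurable_frame_box l : measurable (frame_box l : set (borel 'rV[R]_n)).
Proof.
rewrite (_ : frame_box l = \bigcap_(i : 'I_n)
   ((fun v : borel 'rV[R]_n => dotp (row i G^T : borel 'rV[R]_n) v) @^-1` `[- l
     i, l i])).
  apply: (@fin_bigcap_measurable _ (borel 'rV[R]_n)) => [|i _];
    first exact: finite_finset.
  rewrite -[X in measurable X]setTI.
  have m : measurable_fun setT (fun v : borel 'rV[R]_n => dotp (row i G^T :
    borel 'rV[R]_n) v).
    exact: (measurable_dotp (measurable_cst (row i G^T : borel 'rV[R]_n))
      (@measurable_id _ (borel 'rV[R]_n) setT)).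
  exact: m measurableT _ (measurable_itv `[- l i, l i]).
have E v i : (v *m G) 0 i = dotp (row i G^T) v.
  by rewrite mxE dotpC; apply: eq_bigr => k _; rewrite !mxE.
apply/seteqP; split => v /= H i.
  by move=> _ /=; rewrite in_itv/= -ler_norml -E; exact: H.
by have := H i I; rewrite /= in_itv/= -ler_norml -E.
Qed.

(* [l j] is at most 1, so at most [2 / l j] translates along the [j]-th frame
   vector cover the longer box. *)
Let frame_box_step (l : nat -> R) j : (j < n)%N -> 0 < l j <= 1 ->
  (volume (frame_box (fun i => if i == j then 1%R else l i)) <=
   (2 / l j)%:E * volume (frame_box l))%E.
Proof.
move=> jn /andP[lj0 lj1].
pose m := (Num.truncn (l j)^-1).+1.
have /andP[m1 m2] : (Num.truncn (l j)^-1)%:R <= (l j)^-1 < m%:R.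
  by rewrite truncn_itv// invr_ge0 ltW.
pose e : 'rV[R]_n := delta_mx 0 (Ordinal jn) *m G^T.
have eG : e *m G = delta_mx 0 (Ordinal jn).
  by rewrite -mulmxA (mulmx1C GO) mulmx1.
(* The segment from 1 down to -1 along [e] is cut into pieces of length [2 * l j], and [c k] moves
   the centre of the [k]-th piece to 0. *)
pose c (k : nat) := ((2 * k%:R + 1) * l j - 1) *: e.
have := @volume_covering R n (frame_box l) (frame_box (fun i => if i == j then
  1 else l i)) c m
  (measurable_frame_box l) (measurable_frame_box _).
have cover v : frame_box (fun i => if i == j then 1 else l i) v ->
    exists2 k, (k < m)%N & frame_box l (c k + v).
  move=> vB; have /= := vB (Ordinal jn); rewrite eqxx.
  set p := (v *m G) 0 _; rewrite ler_norml => /andP[p1 p2].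
  pose q := (1 - p) / (2 * l j).
  have q0 : 0 <= q.
    by apply: divr_ge0; [lra|apply: mulr_ge0 => //; exact: ltW].
  pose k := Num.truncn q; have /andP[] := truncn_itv q0; rewrite -/k => k1 k2.
  have kp : 1 - p = q * (2 * l j) by rewrite divfK// mulf_neq0 ?gt_eqF.
  exists k.
    rewrite -(ltr_nat R); apply: le_lt_trans k1 (le_lt_trans _ m2).
    rewrite ler_pdivrMr ?mulr_gt0//.
    by rewrite mulrCA mulVf ?gt_eqF//; lra.
  move=> i; rewrite (_ : ((c k + v) *m G) 0 i =
      ((2 * k%:R + 1) * l j - 1) * (i == Ordinal jn)%:R + (v *m G) 0 i);
        last first.
    by rewrite mulmxDl -scalemxAl eG [LHS]mxE; congr (_ + _); rewrite !mxE eqxx.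
  have [/eqP ij|ij] := boolP (i == Ordinal jn).
    rewrite ij mulr1 -/p /= ler_norml.
    have : k%:R * (2 * l j) <= q * (2 * l j) by rewrite ler_pM2r ?mulr_gt0.
    have : q * (2 * l j) < (k.+1)%:R * (2 * l j) by rewrite ltr_pM2r ?mulr_gt0.
    rewrite -kp -natr1 => ? ?; apply/andP; split; lra.
  rewrite mulr0 add0r; have := vB i.
  by rewrite ifN//; apply: contra ij => /eqP ij; apply/eqP/val_inj.
move=> /(_ cover) /le_trans; apply.
apply: lee_wpmul2r; first by rewrite volume_ge0//; exact: measurable_frame_box.
rewrite lee_fin /m -natr1; have : 1 <= (l j)^-1 by rewrite invf_ge1.
by move: m1; rewrite (_ : 2 / l j = (l j)^-1 + (l j)^-1); [lra|ring].
Qed.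

(** The sides are stretched to half-length 1 one after the other, at the cost of a factor [2 / l i]
    each. The final box contains the axis-parallel cube of half-side [1 / n], whatever the frame. *)
Lemma volume_frame_box_ge (l : nat -> R) : (0 < n)%N -> (forall i,
  0 < l i <= 1) ->
  (((\prod_(i < n) (l i / 2)) * (2 / n%:R) ^+ n)%R%:E <= volume (frame_box l))%E.
Proof.
move=> n0 l01.
pose lk k i := if (i < k)%N then 1 else l i.
have step k : (k <= n)%N ->
    ((\prod_(i < k) (l i / 2))%R%:E * volume (frame_box (lk k)) <= volume
      (frame_box l))%E.
  elim: k => [|k IH] kn.
    by rewrite big_ord0 mul1e.
  apply: le_trans (IH (ltnW kn)).
  have /andP[lk0 lk1] := l01 k.
  have lkk : lk k k = l k by rewrite /lk ltnn.
  have H := @frame_box_step (lk k) k kn; rewrite lkk l01 in H.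
  rewrite (_ : lk k.+1 = fun i => if i == k then 1 else lk k i); last first.
    by apply/funext => i; rewrite /lk ltnS leq_eqVlt; case: eqP.
  have p0 : 0 <= \prod_(i < k) (l i / 2).
    by apply: prodr_ge0 => i _; rewrite divr_ge0//; have /andP[/ltW] := l01 i.
  rewrite big_ord_recr EFinM -muleA; apply: lee_wpmul2l; first by rewrite lee_fin.
  apply: le_trans (lee_wpmul2l _ (H isT)) _;
    first by rewrite lee_fin divr_ge0// ltW.
  rewrite muleA -EFinM (_ : l k / 2 * (2 / l k) = 1) ?mul1e//.
  by field; rewrite gt_eqF.
apply: le_trans (step n (leqnn n)).
rewrite EFinM; apply: lee_wpmul2l.
  by rewrite lee_fin; apply: prodr_ge0 => i _; rewrite divr_ge0//;
    have /andP[/ltW] := l01 i.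
have n0' : (0 : R) < n%:R by rewrite ltr0n.
have i0 : 0 < n%:R^-1 :> R by rewrite invr_gt0.
have ab : - n%:R^-1 <= n%:R^-1 :> R by lra.
have := @volume_cube R n _ _ ab; rewrite (_ : n%:R^-1 - - n%:R^-1 = 2 / n%:R);
  last by ring.
move=> <-; apply: le_volume;
  [exact: measurable_cube|exact: measurable_frame_box|].
move=> v vc i; rewrite /lk ltn_ord.
apply: le_trans (normr_coord_le _ i) _.
rewrite /enorm dotp_orthogonal// -/(enorm v).
apply: le_trans (enorm_le_sum v) _.
have vj j : `|v 0 j| <= n%:R^-1 by rewrite ler_norml; exact: vc.
apply: le_trans (ler_sum _ (fun j _ => vj j)) _.
by rewrite sumr_const card_ord -[_ *+ n]mulr_natr mulVf ?gt_eqF.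
Qed.

End frame_box.

(** * Reflections and orthonormal frames *)

Section frames.
Context {R : realType} {n : nat}.

(** The Householder reflection in the hyperplane orthogonal to [v]. *)
Definition reflection (v : 'rV[R]_n) : 'M[R]_n :=
  1%:M - (2 / dotp v v) *: (v^T *m v).

Lemma mulmx_reflection v c :
  c *m reflection v = c - (2 * dotp c v / dotp v v) *: v.
Proof.
rewrite mulmxBr mulmx1 -scalemxAr mulmxA (_ : c *m v^T = (dotp c v)%:M).
  by rewrite mul_scalar_mx scalerA mulrAC.
by rewrite dotpE; exact: mx11_scalar.
Qed.

Lemma reflection_orthogonal v : dotp v v != 0 ->
  reflection v *m (reflection v)^T = 1%:M.
Proof.
move=> v0; have -> : (reflection v)^T = reflection v.
  by rewrite linearB/= trmx1 linearZ/= trmx_mul trmxK.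
apply/row_matrixP => i; rewrite rowE row1 mulmxA !mulmx_reflection !dotp_lin.
set p := dotp _ v; rewrite -addrA -opprD -scalerDl.
by rewrite [X in X *: _](_ : _ = 0) ?scale0r ?subr0//; field.
Qed.

(** The reflection along [a - b] exchanges the two unit vectors and fixes everything orthogonal to
    both; for [a = b] the identity serves. *)
Lemma reflection_exists (a b : 'rV[R]_n) : dotp a a = 1 -> dotp b b = 1 ->
  exists H : 'M[R]_n, [/\ H *m H^T = 1%:M, a *m H = b &
    forall c, dotp c a = 0 -> dotp c b = 0 -> c *m H = c].
Proof.
move=> a1 b1; have [->|ab] := eqVneq a b.
  by exists 1%:M; split => [||c _ _]; rewrite ?trmx1 mulmx1.
have v0 : dotp (a - b) (a - b) != 0.
  by apply: contra ab => /eqP/dotp_eq0/eqP; rewrite subr_eq0.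
have vv : dotp (a - b) (a - b) = 2 * dotp a (a - b).
  by rewrite !dotp_lin a1 b1 (dotpC b a); ring.
exists (reflection (a - b)); split.
- exact: reflection_orthogonal.
- by rewrite mulmx_reflection -vv divff// scale1r subKr.
- move=> c ca cb; rewrite mulmx_reflection [dotp c _]dotpDr dotpNr ca cb subr0.
  by rewrite mulr0 mul0r scale0r subr0.
Qed.

End frames.

(** One reflection moves [a] to the first basis vector, another moves the image of [b] to the
    second. The latter fixes the first basis vector, which is orthogonal to both vectors it
    exchanges. *)
Lemma orthonormal_frame (R : realType) d (a b : 'rV[R]_d.+2) :
  dotp a a = 1 -> dotp b b = 1 -> dotp a b = 0 ->
  exists G : 'M[R]_d.+2, [/\ G *m G^T = 1%:M, a *m G = delta_mx 0 0,
    forall v, (v *m G) 0 0 = dotp v a & forall v, (v *m G) 0 1 = dotp v b].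
Proof.
move=> a1 b1 ab.
pose e i : 'rV[R]_d.+2 := delta_mx 0 i.
have eE v i : dotp v (e i) = v 0 i.
  rewrite /dotp (bigD1 i)//= mxE !eqxx mulr1 big1 ?addr0// => j /negPf ji.
  by rewrite mxE ji andbF mulr0.
have e1 i : dotp (e i) (e i) = 1 by rewrite eE mxE !eqxx.
have [H [HO aH _]] := reflection_exists a1 (e1 0).
have bH1 : dotp (b *m H) (b *m H) = 1 by rewrite dotp_orthogonal.
have [K [KO bK cK]] := reflection_exists bH1 (e1 1).
have e0K : e 0 *m K = e 0.
  apply: cK; last by rewrite eE mxE.
  by rewrite -aH dotp_orthogonal.
have GO : (H *m K) *m (H *m K)^T = 1%:M.
  by rewrite trmx_mul mulmxA -(mulmxA H) KO mulmx1.
have aG : a *m (H *m K) = delta_mx 0 0 by rewrite mulmxA aH.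
exists (H *m K); split => // v.
  by rewrite -(dotp_orthogonal v a GO) (mulmxA a) aH e0K eE.
by rewrite -(dotp_orthogonal v b GO) (mulmxA b) bK eE.
Qed.

(** * The spherical measure of caps, zones and lenses *)

(* [(P, Q)] is [(cos s, sin s)] with [tan (s / 2) = T0 * (1 + c * eps)], slightly
   beyond [T0 = tan a]; the first bound says that [s] exceeds [2 a], the second
   that the direction [s] still lies in the ball [Q > k * (1 - P)]. *)
Lemma sector_direction (R : realType) (T0 c3 : R) : 0 < T0 -> 0 < c3 ->
  exists2 g, 0 < g & forall eps k, 0 < eps <= 1 -> 0 <= k <= T0^-1 - c3 * eps ->
    exists P Q, [/\ P ^+ 2 + Q ^+ 2 = 1,
      g * eps <= (1 - T0 ^+ 2) / (1 + T0 ^+ 2) - P &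
      g * eps <= Q - k * (1 - P)].
Proof.
(* This choice turns the bound on [k] into [k * T0 <= 1 - 2 * c * eps], which leaves room for the
   factor [1 + c * eps]. *)
move=> T00 c30; pose c := c3 * T0 / 2.
have c0 : 0 < c by rewrite divr_gt0// mulr_gt0.
(* An upper bound for [1 + T ^+ 2], uniform in [eps <= 1]. *)
pose M := 1 + T0 ^+ 2 * (1 + c) ^+ 2.
have sq (z : R) : 0 < 1 + z ^+ 2 by have := sqr_ge0 z; lra.
have M0 : 0 < M by rewrite /M -exprMn.
exists (Num.min (4 * c * T0 ^+ 2 / ((1 + T0 ^+ 2) * M)) (2 * T0 * c / M)).
  by rewrite lt_min !divr_gt0// ?mulr_gt0// ?exprn_gt0.
move=> eps k /andP[e0 e1] /andP[k0 kT0].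
pose T := T0 * (1 + c * eps).
have ce0 : 0 < c * eps by rewrite mulr_gt0.
have TT0 : T0 < T by rewrite /T ltr_pMr//; lra.
have T_gt0 : 0 < T by exact: lt_trans TT0.
have TM : 1 + T ^+ 2 <= M.
  rewrite /M /T exprMn lerD2l ler_pM2l ?exprn_gt0// ler_sqr ?nnegrE; [|lra|lra].
  by rewrite lerD2l ler_piMr// ltW.
have sqT := sq T; have sqT0 := sq T0.
exists ((1 - T ^+ 2) / (1 + T ^+ 2)), (2 * T / (1 + T ^+ 2)); split.
- by field; rewrite gt_eqF.
- rewrite (_ : _ - _ = 2 * (T ^+ 2 - T0 ^+ 2) / ((1 + T0 ^+ 2) * (1 + T ^+
  2))); last first.
    by field; rewrite !gt_eqF.
  apply: (@le_trans _ _ (4 * c * T0 ^+ 2 / ((1 + T0 ^+ 2) * M) * eps)).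
    by rewrite ler_pM2r// ge_min lexx.
  rewrite mulrAC; apply: ler_pM.
  - by rewrite !mulr_ge0 ?sqr_ge0// ltW.
  - by rewrite invr_ge0 mulr_ge0// ltW.
  - have : 0 <= (c * eps * T0) ^+ 2 by exact: sqr_ge0.
    rewrite /T !expr2; lra.
  - by rewrite lef_pV2 ?posrE ?mulr_gt0// ler_pM2l.
- rewrite (_ : _ - _ = 2 * T * (1 - k * T) / (1 + T ^+ 2)); last first.
    by field; rewrite !gt_eqF.
  apply: (@le_trans _ _ (2 * T0 * c / M * eps)).
    by rewrite ler_pM2r// ge_min lexx orbT.
  rewrite mulrAC; apply: ler_pM.
  - by rewrite !mulr_ge0// ltW.
  - by rewrite invr_ge0 ltW.
  - have kT : k * T <= 1 - c * eps.
      apply: (@le_trans _ _ ((T0^-1 - c3 * eps) * T)); first by rewrite ler_pM2r.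
      rewrite (_ : _ * T = (1 - 2 * (c * eps)) * (1 + c * eps)); last first.
        by rewrite /T /c; field; rewrite gt_eqF.
      by have := sqr_ge0 (c * eps); lra.
    rewrite -[_ * c * eps]mulrA; apply: ler_pM.
    + by apply: mulr_ge0 => //; exact: ltW.
    + exact: ltW.
    + by rewrite ler_pM2l// ltW.
    + lra.
  - by rewrite lef_pV2.
Qed.

(** For a point [v] of the box, [al] and [be] are its coordinates along [P x + Q u] and
    [- Q x + P u], [rho] is the squared length of the rest and [m] the norm; the conclusions are the
    lens inequalities multiplied by [m]. On the axis they hold with a margin of order [g * eps], and
    the deviations from it cost only order [b * eps]. *)
Lemma sector_box (R : realType) (al be rho m P Q k k0 tau0 eps b g dl : R) :
  P ^+ 2 + Q ^+ 2 = 1 -> g * eps <= tau0 - P -> g * eps <= Q - k * (1 - P) ->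
  `|tau0| <= 1 -> 0 <= k <= k0 -> 0 < eps <= 1 -> 0 < b -> b <= 1 / 16 ->
  20 * b <= g -> 8 * b * (1 + 5 * k0) <= g -> 0 <= dl <= g * eps / 16 ->
  1 / 4 <= al <= 1 / 2 -> `|be| <= b * eps -> 0 <= rho <= b * eps ->
  0 <= m -> m ^+ 2 = al ^+ 2 + be ^+ 2 + rho ->
  [/\ 0 < m <= 1, P * al - Q * be <= tau0 * m &
    k * (m - (P * al - Q * be)) + dl * m < Q * al + P * be].
Proof.
move=> PQ gP gQ tau01 /andP[k_ge0 kk0] /andP[e0 e1] b0 b1 bg bkg /andP[dl0 dlg].
move=> /andP[al1 al2] beb /andP[rho0 rhob] m0 mE.
have be0 : 0 < b * eps by rewrite mulr_gt0.
have beb1 : b * eps <= b by rewrite ler_piMr// ltW.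
have bee : be ^+ 2 <= b * eps.
  rewrite -real_normK ?num_real// expr2.
  apply: (@le_trans _ _ (b * eps * 1)); last by rewrite mulr1.
  by apply: ler_pM => //; lra.
have alm : al <= m by rewrite -ler_sqr ?nnegrE; [have := sqr_ge0 be; lra|lra|lra].
(* Here [al >= 1 / 4] matters: [m ^+ 2 - al ^+ 2] is at most [2 * b * eps]. *)
have mal : m <= al + 4 * (b * eps).
  rewrite -ler_sqr ?nnegrE; [|lra|lra].
  rewrite mE; have := sqr_ge0 (b * eps).
  have : 1 / 4 * (b * eps) <= al * (b * eps) by rewrite ler_pM2r.
  lra.
have abs1 (z w : R) : z ^+ 2 + w ^+ 2 = 1 -> `|z| <= 1.
  move=> zw; rewrite -sqrtr_sqr -[leRHS]sqrtr1 ler_wsqrtr//.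
  by have := sqr_ge0 w; lra.
have P1 := abs1 _ _ PQ; have Q1 : `|Q| <= 1 by apply: (abs1 _ P); rewrite addrC.
have prod_le (z w c : R) : `|z| <= 1 -> `|w| <= c -> `|z * w| <= c.
  by move=> z1 wc; rewrite normrM -[c]mul1r ler_pM.
have Qb : `|Q * be| <= b * eps by exact: prod_le.
have Pb : `|P * be| <= b * eps by exact: prod_le.
have tm : `|tau0 * (m - al)| <= 4 * (b * eps).
  by apply: prod_le => //; rewrite ler_norml; apply/andP; split; lra.
have ge0 : 0 < g * eps by rewrite mulr_gt0//; lra.
have bge : 20 * (b * eps) <= g * eps by rewrite mulrA ler_pM2r.
move: Qb Pb tm; rewrite !ler_norml => /andP[? ?] /andP[? ?] /andP[? ?].
split; first by apply/andP; split; lra.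
  have : 1 / 4 * (g * eps) <= al * (tau0 - P) by apply: ler_pM => //; lra.
  lra.
have : 1 / 4 * (g * eps) <= al * (Q - k * (1 - P)) by apply: ler_pM => //; lra.
have : k * (m - al) <= k0 * (4 * (b * eps)) by apply: ler_pM => //; lra.
have : k * (Q * be) <= k0 * (b * eps).
  apply: le_trans (ler_wpM2l k_ge0 (_ : Q * be <= b * eps)) _ => //.
  by rewrite ler_pM2r.
have : dl * m <= g * eps / 16 * 1 by apply: ler_pM => //; lra.
have : 8 * b * (1 + 5 * k0) * eps <= g * eps by rewrite ler_pM2r.
lra.
Qed.

Section sphere_measure.
Context {R : realType} {d : nat}.
Implicit Types A B : set (borel 'rV[R]_d.+1).

Definition sph A : R := fine (sigma_sphere A).

Lemma volume_pcone_fin A : measurable A -> volume (pcone A) \is a fin_num.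
Proof.
move=> mA; rewrite ge0_fin_numE ?volume_ge0//; last exact: measurable_pcone.
apply: (@le_lt_trans _ _ (2 ^+ d.+1)%:E); last exact: ltry.
have -> : ((2 ^+ d.+1)%:E = volume (@cube R d.+1 (-1) 1)).
  by rewrite volume_cube; [congr (_ ^+ _)%:E; lra|lra].
apply: le_volume; [exact: measurable_pcone|exact: measurable_cube|].
move=> v [/andP[_ v1] _] i; rewrite -ler_norml.
exact: le_trans (normr_coord_le v i) v1.
Qed.

Lemma measurable_sphere : measurable (@sphere R d : set (borel 'rV[R]_d.+1)).
Proof.
rewrite (_ : @sphere R d = (@enorm R d.+1 : borel 'rV[R]_d.+1 ->
  R) @^-1` [set 1]).
  by rewrite -[X in measurable X]setTI; exact: measurable_enorm.
by apply/seteqP; split => v; rewrite sphereE.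
Qed.

Definition ball_volume : R := fine (volume (cone_over (@sphere R d))).

(** The unit ball contains the cube of half-side [1 / d.+1]; the apex is restored first, as [pcone]
    omits it. *)
Lemma ball_volume_gt0 : 0 < ball_volume.
Proof.
rewrite /ball_volume volume_cone_over; last exact: measurable_sphere.
have mp := measurable_pcone measurable_sphere.
have fp := volume_pcone_fin measurable_sphere.
rewrite volumeE// in fp.
rewrite fine_gt0// ltey_eq fp andbT.
pose e : R := d.+1%:R^-1; have e0 : 0 < e by rewrite invr_gt0.
have ab : - e <= e by lra.
suff : (volume (@cube R d.+1 (- e) e) <= volume_measure d.+1 (pcone (@sphere R
  d)))%E.
  by apply: lt_le_trans; rewrite volume_cube// lte_fin exprn_gt0//; lra.
have m0 := measurable_set1_row (0 : 'rV[R]_d.+1).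
apply: (@le_trans _ _ (volume ((pcone (@sphere R d) : set (borel 'rV[R]_d.+1))
  `|` [set 0]))).
  apply: le_volume; [exact: measurable_cube|exact: measurableU|].
  move=> v ve; have [->|v0] := eqVneq v 0; [by right|left].
  split; last by rewrite sphereE enorm_normalize.
  rewrite lt_def enorm_ge0 andbT; apply/andP; split.
    by apply: contra v0 => /eqP/enorm_eq0/eqP.
  apply: le_trans (enorm_le_sum v) _.
  have vj j : `|v 0 j| <= e by rewrite ler_norml; exact: ve.
  apply: le_trans (ler_sum _ (fun j _ => vj j)) _.
  by rewrite sumr_const card_ord -[_ *+ d.+1]mulr_natr mulVf.
rewrite volumeE; last exact: measurableU.
rewrite measureU//; last first.
  by apply/seteqP; split => // v [[/andP[v0 _] _] /= vE]; move: v0;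
    rewrite vE /enorm dotp0l sqrtr0 ltxx.
by rewrite [X in (_ + X)%E](_ : _ = 0%E) ?adde0//= -volumeE// volume_set10.
Qed.

Lemma sphE A : measurable A -> sph A = fine (volume (pcone A)) / ball_volume.
Proof.
move=> mA; transitivity (fine (volume (cone_over A)) / ball_volume) => //.
by rewrite volume_cone_over// volumeE//; exact: measurable_pcone.
Qed.

Lemma sph_ge0 A : measurable A -> 0 <= sph A.
Proof.
move=> mA; rewrite sphE// divr_ge0 ?(ltW ball_volume_gt0)//.
by rewrite fine_ge0// volume_ge0//; exact: measurable_pcone.
Qed.

(** [pcone] commutes with unions and preserves disjointness, so additivity is inherited from the
    volume. *)
Lemma sphU A B : measurable A -> measurable B -> A `&` B = set0 ->
  sph (A `|` B) = sph A + sph B.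
Proof.
move=> mA mB AB; have mAB := measurableU _ _ mA mB.
have mpA := measurable_pcone mA; have mpB := measurable_pcone mB.
rewrite !sphE// -mulrDl -fineD ?volume_pcone_fin//; congr (fine _ / _).
have -> : pcone (A `|` B) = (pcone A : set (borel 'rV[R]_d.+1)) `|` pcone B.
  by apply/seteqP; split => v; rewrite /pcone /=; tauto.
rewrite !volumeE//; last exact: measurableU.
rewrite measureU//; apply/seteqP; split => // v [[_ Av] [_ Bv]].
by suff : set0 (normalize v) by []; rewrite -AB.
Qed.

Lemma sphI A B : measurable A -> measurable B ->
  sph A = sph (A `&` B) + sph (A `\` B).
Proof.
move=> mA mB; rewrite -sphU ?setUIDK//; [exact: measurableI|exact: measurableD|].
by apply/seteqP; split => // v [[? ?] []].
Qed.

Lemma le_sph A B : measurable A -> measurable B -> A `<=` B -> sph A <= sph B.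
Proof.
move=> mA mB AB; rewrite (sphI mB mA) (_ : B `&` A = A); last exact: setIidr.
by rewrite lerDl sph_ge0//; exact: measurableD.
Qed.

Lemma sph_subadd A B : measurable A -> measurable B ->
  sph (A `|` B) <= sph A + sph B.
Proof.
move=> mA mB; rewrite (_ : A `|` B = A `|` (B `\` A)); last first.
  by apply/seteqP; split => v /=; have [] := pselect (A v); tauto.
rewrite sphU//; last 2 first.
- exact: measurableD.
- by rewrite setDIK.
by rewrite lerD2l; apply: le_sph => //; exact: measurableD.
Qed.

Lemma sphD_ge A B : measurable A -> measurable B -> sph A - sph B <= sph (A `\`
  B).
Proof.
move=> mA mB; rewrite (sphI mA mB) lerBlDr addrC lerD2l.
by apply: le_sph => //; exact: measurableI.
Qed.

Lemma sph_ge_volume A B : measurable A -> measurable B -> A `<=` pcone B ->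
  fine (volume A) / ball_volume <= sph B.
Proof.
move=> mA mB AB; rewrite sphE// ler_pM2r ?invr_gt0 ?ball_volume_gt0//.
have mpB := measurable_pcone mB.
have H := le_volume mA mpB AB; apply: fine_le => //; last exact: volume_pcone_fin.
rewrite ge0_fin_numE ?volume_ge0//; apply: le_lt_trans H _.
by rewrite -ge0_fin_numE ?volume_ge0// volume_pcone_fin.
Qed.

Lemma sphere_normalize (v : 'rV[R]_d.+1) : 0 < enorm v -> sphere (normalize v).
Proof.
move=> v0; rewrite sphereE enorm_normalize//; apply: contraTneq v0 => ->.
by rewrite /enorm dotp0l sqrtr0 ltxx.
Qed.

Lemma dotp_normalize (x v : 'rV[R]_d.+1) : dotp x (normalize v) = dotp x v /
  enorm v.
Proof. by rewrite dotpZr mulrC. Qed.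

Lemma enorm_normalizeK (v : 'rV[R]_d.+1) : 0 < enorm v -> v = enorm v *:
  normalize v.
Proof. by move=> v0; rewrite scalerA mulfV ?gt_eqF// scale1r. Qed.

(** Scaling by [enorm v <= 1] puts the cone over the zone into the band of [volume_band]. The
    constant depends on [tau] and the dimension only. *)
Lemma sph_band (tau : R) : `|tau| < 1 -> exists2 C, 0 < C &
  forall x delta, sphere x -> 0 < delta -> delta <= (1 - `|tau|) / 3 ->
  forall A, measurable A -> (forall z, sphere z -> A z -> `|dotp x z - tau| <=
    delta) ->
  sph A <= C * delta.
Proof.
move=> tau1; have t0 : 0 < 1 - `|tau| by lra.
exists (4 ^+ d.+1 * 3 / (1 - `|tau|) / ball_volume).
  by rewrite !divr_gt0 ?mulr_gt0 ?exprn_gt0// ball_volume_gt0.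
move=> x delta x1 d0 dtau A mA Ax.
rewrite sphE// [leRHS]mulrAC ler_pM2r ?invr_gt0 ?ball_volume_gt0//.
have := volume_band x1 d0 dtau; set B := [set v | _] => H.
have [mB|nmB] := pselect (measurable (B : set (borel _))); last first.
  by exfalso; apply: nmB; exact: measurable_band.
rewrite -lee_fin fineK ?volume_pcone_fin//.
apply: le_trans (le_trans H _).
  apply: le_volume => //; first exact: measurable_pcone.
  move=> v [/andP[v0 v1] Av]; split => //.
  rewrite {1}(enorm_normalizeK v0) dotpZr [tau * _]mulrC -mulrBr normrM
    (ger0_norm (ltW v0)).
  apply: le_trans (_ : 1 * delta <= _); last by rewrite mul1r.
  apply: ler_pM => //; first exact: ltW.
  by apply: Ax => //; exact: sphere_normalize.
by rewrite lee_fin le_eqVlt; apply/orP; left; apply/eqP; ring.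
Qed.

End sphere_measure.

Lemma normr_cos_tan_le1 (R : realType) (t : R) :
  `|(1 - t ^+ 2) / (1 + t ^+ 2)| <= 1.
Proof.
have t2 := sqr_ge0 t; have t3 : 0 < 1 + t ^+ 2 by lra.
rewrite ler_norml ler_pdivrMr// ler_pdivlMr// mul1r mulN1r.
by apply/andP; split; lra.
Qed.

(* The cone over the lens contains a box with one side of order 1, one of order
   [eps], and [d] sides of order [sqrt eps]. *)
Lemma sph_lens (R : realType) d (T0 c3 : R) : 0 < T0 -> 0 < c3 ->
  exists2 b, 0 < b & exists2 g, 0 < g &
  forall eps k dl (x u : 'rV[R]_d.+2), 0 < eps <= 1 ->
    0 <= k <= T0^-1 - c3 * eps -> 0 <= dl <= g * eps ->
    sphere x -> sphere u -> dotp x u = 0 ->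
    forall A : set (borel 'rV[R]_d.+2), measurable A ->
    (forall z, sphere z -> dotp x z <= (1 - T0 ^+ 2) / (1 + T0 ^+ 2) ->
      k * (1 - dotp x z) + dl < dotp u z -> A z) ->
    b * Num.sqrt eps ^+ d.+2 <= sph A.
Proof.
move=> T00 c30; have [g g0 gP] := sector_direction T00 c30.
pose tau0 := (1 - T0 ^+ 2) / (1 + T0 ^+ 2).
have tau01 : `|tau0| <= 1 by exact: normr_cos_tan_le1.
pose k0 := T0^-1.
have k00 : 0 < k0 by rewrite invr_gt0.
have [b [b0 b1 bg bkg]] : exists b, [/\ 0 < b, b <= 1 / 16, 20 * b <= g & 8 * b
  * (1 + 5 * k0) <= g].
  pose M := 20 + 8 * (1 + 5 * k0).
  have M0 : 0 < M by rewrite /M; lra.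
  exists (Num.min (1 / 16) (g / M)).
  have bM : Num.min (1 / 16) (g / M) * M <= g.
    by rewrite -ler_pdivlMr// ge_min lexx orbT.
  have b0 : 0 < Num.min (1 / 16) (g / M) by rewrite lt_min !divr_gt0.
  set b := Num.min _ _ in bM b0 *.
  have bk : 0 < b * k0 by rewrite mulr_gt0.
  split => //; first by rewrite ge_min lexx.
    by move: bM; rewrite /M; lra.
  by move: bM; rewrite /M; lra.
pose n := d.+2.
(* The [d] short sides, of half-length [b2 * s] with [s] the root of [eps], then contribute at most
   [b * eps] to the squared norm, as [sector_box] demands of [rho]. *)
pose b2 := b / n%:R.
have n1 : (1 : R) <= n%:R by rewrite ler1n.
have b20 : 0 < b2 by rewrite divr_gt0//; lra.
have b21 : b2 <= 1 by rewrite ler_pdivrMr ?mul1r//; lra.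
have b2d : b2 ^+ 2 * d%:R <= b.
  rewrite /b2 (_ : (b / n%:R) ^+ 2 * d%:R = b * (b * (n%:R^-1 * (d%:R /
    n%:R)))); last by ring.
  have nn : n%:R^-1 <= 1 :> R by rewrite invf_le1 ?ltr0n.
  have dn : d%:R / n%:R <= 1 :> R by rewrite ler_pdivrMr ?ltr0n// mul1r ler_nat
    leqW// leqnSn.
  rewrite -[leRHS]mulr1; apply: ler_pM => //; first exact: ltW.
    by rewrite !mulr_ge0 ?invr_ge0// ltW.
  have b_le1 : b <= 1 by apply: le_trans b1 _; lra.
  have nd : n%:R^-1 * (d%:R / n%:R) <= 1 :> R by apply: mulr_ile1.
  by apply: mulr_ile1 => //; exact: ltW.
clearbody b2.
(* The bound of [volume_frame_box_ge] with the powers of [eps] taken out. *)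
pose K := (1 / 8 / 2) * (b / 2) * (b2 / 2) ^+ d * (2 / n%:R) ^+ n.
have K0 : 0 < K.
  have n0 : (0 : R) < n%:R by lra.
  by rewrite /K !(exprn_gt0, mulr_gt0, invr_gt0).
exists (K / ball_volume (d := d.+1)); first by rewrite divr_gt0// ball_volume_gt0.
exists (g / 16); first by rewrite divr_gt0.
move=> eps k dl x u eps01 kk0 /andP[dl0 dlg] x1 u1 xu A mA AP.
have /andP[e0 e1] := eps01.
have kk : 0 <= k <= k0.
  have /andP[k_ge0 kle] := kk0; apply/andP; split => //.
  apply: (le_trans kle); rewrite gerBl; apply: mulr_ge0; exact: ltW.
have dl01 : 0 <= dl <= g * eps / 16 by rewrite dl0/= mulrAC.
have [P [Q [PQ]]] := gP _ _ eps01 kk0; rewrite -/tau0 => gPe gQe.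
(* The axis of the box lies in the plane of [x] and [u], slightly beyond the cap. *)
pose e1v := P *: x + Q *: u; pose e2v := (- Q) *: x + P *: u.
have ux : dotp u x = 0 by rewrite dotpC.
have e11 : dotp e1v e1v = 1.
  by rewrite -[RHS]PQ /e1v !dotp_lin x1 u1 xu ux; ring.
have e22 : dotp e2v e2v = 1.
  by rewrite -[RHS]PQ /e2v !dotp_lin x1 u1 xu ux; ring.
have e12 : dotp e1v e2v = 0.
  by rewrite /e1v /e2v !dotp_lin x1 u1 xu ux; ring.
have [G [GO e1G G0 G1]] := orthonormal_frame e11 e22 e12.
pose s := Num.sqrt eps.
have s0 : 0 < s by rewrite sqrtr_gt0.
have s2 : s ^+ 2 = eps by rewrite sqr_sqrtr// ltW.
have s1 : s <= 1 by rewrite -sqrtr1 ler_wsqrtr.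
rewrite -/s; clearbody s.
(* Centred at [3 / 8] on the axis, the half-length [1 / 8] gives coordinates between [1 / 4] and
   [1 / 2]. *)
pose l (i : nat) := match i with 0%N => 1 / 8 | 1%N => b * eps | _ => b2 * s end.
have be : 0 < b * eps by rewrite mulr_gt0.
have beb : b * eps <= b by rewrite ler_piMr// ltW.
have l01 i : 0 < l i <= 1.
  case: i => [|[|i]]; rewrite /l; apply/andP; split.
  - lra.
  - lra.
  - exact: be.
  - by apply: le_trans beb _; lra.
  - by rewrite mulr_gt0.
  - by rewrite -[leRHS]mulr1; apply: ler_pM => //; exact: ltW.
have vol := volume_frame_box_ge GO (isT : (0 < d.+2)%N) l01.
have El : \prod_(i < n) (l i / 2) * (2 / n%:R) ^+ n = K * s ^+ n.
  rewrite big_ord_recl big_ord_recl /= (eq_bigr (fun=> b2 * s / 2)) //.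
  rewrite prodr_const card_ord /K -s2 (_ : b2 * s / 2 = b2 / 2 * s); last by ring.
  have sn : s ^+ n = s ^+ 2 * s ^+ d by rewrite -exprD.
  rewrite exprMn sn; ring.
rewrite El in vol; clear El; clearbody K.
pose B : set (borel 'rV[R]_d.+2) := +%R (- (3 / 8) *: e1v) @^-1` frame_box G l.
have mB : measurable B.
  rewrite -[X in measurable X]setTI; apply: measurable_shift => //.
  exact: measurable_frame_box.
have volB : volume B = volume (frame_box G l) by apply: volume_shift;
  exact: measurable_frame_box.
have BA : B `<=` pcone A.
  move=> v vB; pose al := (v *m G) 0 0; pose be' := (v *m G) 0 1.
  pose rho := \sum_(i < d) (v *m G) 0 (lift ord0 (lift ord0 i)) ^+ 2.
  have vG i : (v *m G) 0 i = (3 / 8) * (i == 0)%:R + ((- (3 / 8) *: e1v + v) *m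
    G) 0 i.
    rewrite mulmxDl -scalemxAl e1G [X in _ = _ + X]mxE addrA.
    by rewrite [X in _ + X + _]mxE [X in _ + _ * X + _]mxE eqxx/= -mulrDl subrr
      mul0r add0r.
  have rho_ge0 : 0 <= rho by apply: sumr_ge0 => i _; exact: sqr_ge0.
  have rho_le : rho <= b * eps.
    have vi (i : 'I_d) : (v *m G) 0 (lift ord0 (lift ord0 i)) ^+ 2 <= (b2 * s)
      ^+ 2.
      set y := (v *m G) _ _.
      have yb : `|y| <= b2 * s.
        by rewrite /y vG mulr0 add0r; exact: (vB (lift ord0 (lift ord0 i))).
      by rewrite -[y ^+ 2](real_normK (num_real y)) !expr2; apply: ler_pM.
    apply: le_trans (ler_sum _ (fun i _ => vi i)) _.
    rewrite sumr_const card_ord exprMn s2 -[_ *+ d]mulr_natr.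
    by rewrite mulrAC ler_pM2r.
  have al_b : 1 / 4 <= al <= 1 / 2.
    have := vB 0; rewrite /l /= ler_norml => /andP[? ?].
    by rewrite /al vG eqxx/=; apply/andP; split; lra.
  have be_b : `|be'| <= b * eps.
    by rewrite /be' vG mulr0 add0r; exact: (vB 1).
  have mE : enorm v ^+ 2 = al ^+ 2 + be' ^+ 2 + rho.
    rewrite sqr_enorm -(dotp_orthogonal v v GO) /dotp big_ord_recl big_ord_recl.
    rewrite addrA (_ : lift ord0 ord0 = 1); last exact: val_inj.
    by rewrite (expr2 al) (expr2 be'); congr (_ + _ + _).
  have rho01 : 0 <= rho <= b * eps by rewrite rho_ge0.
  have [m01 H1 H2] := sector_box PQ gPe gQe tau01 kk eps01 b0 b1 bg bkg dl01
    al_b be_b rho01 (enorm_ge0 v) mE.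
  have xv : P * al - Q * be' = dotp x v.
    rewrite /al /be' G0 G1 /e1v /e2v !dotp_lin (dotpC v x) (dotpC v u).
    rewrite [RHS](_ : _ = (P ^+ 2 + Q ^+ 2) * dotp x v); last by rewrite PQ mul1r.
    ring.
  have uv : Q * al + P * be' = dotp u v.
    rewrite /al /be' G0 G1 /e1v /e2v !dotp_lin (dotpC v x) (dotpC v u).
    rewrite [RHS](_ : _ = (P ^+ 2 + Q ^+ 2) * dotp u v); last by rewrite PQ mul1r.
    ring.
  rewrite xv uv in H1 H2; have /andP[m0 m1] := m01.
  split; first exact: m01.
  apply: AP.
  - exact: sphere_normalize.
  - by rewrite dotp_normalize ler_pdivrMr.
  - rewrite !dotp_normalize (ltr_pdivlMr _ _ m0).
    move: m0 H2; clear; move: (enorm v) (dotp x v) (dotp u v) => m p q m0 H2.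
    suff -> : (k * (1 - p / m) + dl) * m = k * (m - p) + dl * m by exact: H2.
    by field; rewrite gt_eqF.
apply: le_trans (sph_ge_volume mB mA BA).
have bv : 0 < (@ball_volume R d.+1)^-1 by rewrite invr_gt0;
  exact: ball_volume_gt0.
have Bfin : volume B \is a fin_num.
  rewrite ge0_fin_numE; last exact: volume_ge0.
  apply: le_lt_trans (le_volume mB (measurable_pcone mA) BA) _.
  rewrite -ge0_fin_numE; first exact: volume_pcone_fin.
  by apply: volume_ge0; exact: measurable_pcone.
rewrite mulrAC (ler_pM2r bv) -lee_fin (fineK Bfin) volB; exact: vol.
Qed.

(** * Radii of Voronoi cells *)

Section trigonometry.
Context {R : realType}.
Implicit Types a r : R.

Lemma acos_le (s t : R) : -1 <= s <= 1 -> -1 <= t <= 1 -> (acos s <= acos t) =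
  (t <= s).
Proof.
move=> s1 t1; have [/andP[s0 spi] sE] := acos_def s1.
have [/andP[t0 tpi] tE] := acos_def t1.
rewrite -{2}sE -{2}tE !leNgt; congr (~~ _).
by rewrite ltr_cos// in_itv/= ?s0 ?t0.
Qed.

Lemma cos_le_acos (t r : R) : -1 <= t <= 1 -> 0 <= r <= pi -> (acos t <= r) =
  (cos r <= t).
Proof.
move=> t1 /andP[r0 rpi]; rewrite -{1}(@cosK R r) ?in_itv/= ?r0//.
by rewrite acos_le// cos_geN1 cos_le1.
Qed.

(** With [h = eps / 2], the difference of the cotangents of [a] and [a + h] is
    [sin h / (sin a * sin (a + h))], hence at least [sin h]. The mean value theorem gives
    [sin h >= h * cos (1 / 2)]. *)
Lemma cot_gap a : 0 < a < pi / 2 -> exists2 c, 0 < c &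
  forall eps, 0 < eps <= 1 -> a + eps / 2 < pi / 2 ->
    cos (a + eps / 2) / sin (a + eps / 2) <= (sin a / cos a)^-1 - c * eps.
Proof.
move=> /andP[a0 a2]; have ph := pihalf_ge1 R; have pi0 := pi_gt0 R.
have half_lt : 1 / 2 < pi / 2 :> R by lra.
have ch : 0 < cos (1 / 2 : R) by apply: cos_gt0_pihalf; apply/andP; split; lra.
exists (cos (1 / 2) / 2); first by rewrite divr_gt0.
move=> eps /andP[e0 e1]; set r := a + eps / 2 => r2.
have sa : 0 < sin a by apply: sin_gt0_pi; apply/andP; split; lra.
have sr : 0 < sin r by apply: sin_gt0_pi; apply/andP; split; rewrite /r; lra.
have e2 : 0 < eps / 2 by lra.
have [c + cE] := MVT e2 (fun x _ => is_derive_sin x) (continuous_subspaceT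
  (@continuous_sin R)).
rewrite in_itv/= => /andP[c0 c1].
have cc : cos (1 / 2) <= cos c.
  rewrite leNgt ltr_cos ?in_itv/=; [by rewrite -leNgt; lra|by apply/andP;
    split; lra..].
have sre : sin (eps / 2) = sin r * cos a - cos r * sin a.
  by rewrite -sinB; congr sin; rewrite /r; ring.
have H : cos (1 / 2) / 2 * eps <= sin (eps / 2).
  move: cE; rewrite sin0 !subr0 => ->.
  by rewrite mulrAC -mulrA ler_pM2r.
rewrite invf_div lerBrDr addrC -lerBrDr.
apply: le_trans H _.
rewrite (_ : _ - _ = sin (eps / 2) / (sin a * sin r)); last first.
  by rewrite sre; field; rewrite !gt_eqF.
have s1 : 0 <= sin (eps / 2).
  by apply: sin_ge0_pi; apply/andP; split; lra.
rewrite ler_pdivlMr ?mulr_gt0//.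
rewrite -[leRHS]mulr1; apply: ler_wpM2l; first exact: s1.
by apply: mulr_ile1; [exact: ltW|exact: ltW|exact: sin_le1|exact: sin_le1].
Qed.

Lemma cos_double_tan a : 0 < cos a ->
  cos (2 * a) = (1 - (sin a / cos a) ^+ 2) / (1 + (sin a / cos a) ^+ 2).
Proof.
move=> ca; have cs := cos2Dsin2 a.
have -> : 2 * a = a + a by ring.
rewrite cosD -!expr2 [RHS](_ : _ = (cos a ^+ 2 - sin a ^+ 2) / (cos a ^+ 2 +
  sin a ^+ 2)).
  by rewrite cs divr1.
by field; rewrite cs oner_neq0 gt_eqF.
Qed.

End trigonometry.

Section typical_cell_geometry.
Context {R : realType} {d : nat}.
Variables (p x : 'rV[R]_d.+1) (phi : 'M[R]_d.+1) (F : set 'rV[R]_d.+1).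
Hypotheses (p1 : sphere p) (phiO : phi *m phi^T = 1%:M) (pphi : p *m phi = x).
Hypotheses (F1 : F `<=` @sphere R d) (Fx : F x).

Let K := mulmxr phi @^-1` voronoi_cell x F.

Let x1 : sphere x. Proof. exact: F1. Qed.

Let geodist_le (y z w : 'rV[R]_d.+1) : sphere y -> sphere z -> sphere w ->
  (geodist y z <= geodist y w) = (dotp y w <= dotp y z).
Proof. by move=> y1 z1 w1; rewrite /geodist acos_le//;
  exact: dotp_unit_bound. Qed.

Let geodist_ler (y z : 'rV[R]_d.+1) (r : R) : sphere y -> sphere z ->
  0 <= r <= pi ->
  (geodist y z <= r) = (cos r <= dotp y z).
Proof. by move=> y1 z1 r0; rewrite /geodist cos_le_acos//;
  exact: dotp_unit_bound. Qed.

Let dotp_phi y z : dotp (y *m phi) (z *m phi) = dotp y z.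
Proof. exact: dotp_orthogonal. Qed.

Let sphere_phi y : sphere y -> sphere (y *m phi).
Proof. by rewrite /sphere /= dotp_phi. Qed.

Let phiTK (y : 'rV[R]_d.+1) : y *m phi^T *m phi = y.
Proof. by rewrite -mulmxA (mulmx1C phiO) mulmx1. Qed.

(** The radius 0 qualifies: that ball is the single point [p], and [p *m phi = x] lies in its own
    cell. *)
Let has_sup_inradius : has_sup [set r | 0 <= r <= pi /\ geoball p r `<=` K].
Proof.
split; last by exists pi => r [/andP[]].
exists 0; split; first by rewrite lexx pi_ge0.
move=> y [y1]; rewrite geodist_ler ?lexx ?pi_ge0// cos0 => py.
have /andP[_ py1] := dotp_unit_bound p1 y1.
have <- : p = y by apply: dotp_unit_inj => //; apply/eqP; rewrite eq_le py py1.
rewrite /K /= pphi; split => // z Fz; have z1 := F1 Fz.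
by rewrite geodist_le// x1; have /andP[] := dotp_unit_bound x1 z1.
Qed.

Lemma inradius_ge a : 0 < a < pi / 2 ->
  (forall z, F z -> z != x -> dotp x z <= cos (2 * a)) -> a <= inradius p K.
Proof.
move=> /andP[a0 a2] far; have pi0 := pi_gt0 R.
have ca : 0 < cos a by apply: cos_gt0_pihalf; apply/andP; split; lra.
have a01 : 0 <= a <= pi by apply/andP; split; lra.
apply: ub_le_sup; first by exists pi => r [/andP[]].
split => // y [y1]; rewrite geodist_ler// => cay.
have y1' := sphere_phi y1; split => // z Fz; rewrite geodist_le//; [|exact: F1].
have yx : dotp (y *m phi) x = dotp p y by rewrite -pphi dotp_phi dotpC.
have [->//|zx] := eqVneq z x.
apply: (@dotp_le_of_cap R _ x (y *m phi) z (cos a)) => //; first exact: F1.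
  by rewrite yx.
apply: le_trans (far z Fz zx) _.
have -> : 2 * a = a + a by ring.
by rewrite cosD -!expr2; have := cos2Dsin2 a; lra.
Qed.

(** If [z] were closer, a ball reaching beyond the midpoint of [x] and [z] would lie in the cell,
    against [dotp_le_of_ball]. *)
Lemma far_of_inradius a : 0 < a < pi / 2 -> a <= inradius p K ->
  forall z, F z -> z != x -> dotp x z <= cos (2 * a).
Proof.
move=> /andP[a0 a2] aK z Fz zx; have pi0 := pi_gt0 R.
rewrite leNgt; apply/negP => far.
have z1 : sphere z by exact: F1.
have xz1 := dotp_unit_bound x1 z1.
have [/andP[t0 tpi] tE] := acos_def xz1; set t := acos _ in t0 tpi tE.
have ta : t < 2 * a.
  rewrite -ltr_cos ?in_itv/=; [by rewrite tE|by apply/andP; split; lra..].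
pose r := (t / 2 + a) / 2.
have [r0 ra rt] : [/\ 0 < r, r < a & t < 2 * r] by rewrite /r; split; lra.
have rK : 0 < inradius p K - r by lra.
have [s [/andP[s0 spi] sK]] := sup_adherent rK has_sup_inradius;
  rewrite -/(inradius p K) subKr => rs.
have : dotp x z <= cos r ^+ 2 - sin r ^+ 2.
  apply: (@dotp_le_of_ball R _ x z (cos r) (sin r)) => //.
  - by rewrite eq_sym.
  - by apply: cos_gt0_pihalf; apply/andP; split; lra.
  - exact: cos2Dsin2.
  - by apply: sin_ge0_pi; apply/andP; split; lra.
  move=> y y1 yx.
  have r0pi : 0 <= r <= pi by apply/andP; split; lra.
  have yp1 : sphere (y *m phi^T) by rewrite /sphere /= -dotp_phi phiTK.
  have : geoball p s (y *m phi^T).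
    split => //; apply: (@le_trans _ _ r); last exact: ltW.
    by rewrite geodist_ler// -dotp_phi phiTK pphi dotpC.
  move=> /sK; rewrite /K /= phiTK => -[_ /(_ z Fz)].
  by rewrite geodist_le.
rewrite !expr2 -cosD -tE leNgt ltr_cos ?in_itv/=; [|by apply/andP; split; lra..].
by rewrite (_ : r + r = 2 * r) ?rt//; ring.
Qed.

(** The circumradius is at least [a + eps], so [K] has a point outside the ball of radius
    [a + eps / 2]. This point lies in the hemisphere, which bounds the radius, and
    [direction_of_far_point] applies to its rotated image. *)
Lemma direction_of_vartheta a eps : 0 < a < pi / 2 -> 0 < eps ->
  a <= inradius p K -> K `<=` geoball p (pi / 2) -> eps <= vartheta p K ->
  a + eps / 2 < pi / 2 /\
  exists u, [/\ sphere u, dotp x u = 0 &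
    forall z, F z -> dotp u z <=
      cos (a + eps / 2) / sin (a + eps / 2) * (1 - dotp x z)].
Proof.
move=> /andP[a0 a2] e0 aK K2 eK; have pi0 := pi_gt0 R.
set r := a + eps / 2.
have rK : r < circumradius p K by move: eK; rewrite /vartheta /r; lra.
have nKr : ~ K `<=` geoball p r.
  move=> Kr; have : circumradius p K <= r; last by lra.
  apply: ge_inf; first by exists 0 => s [].
  by split => //; rewrite /r; lra.
have [y [Ky ny]] : exists y, K y /\ ~ geoball p r y.
  apply: contrapT => H; apply: nKr => y Ky; apply: contrapT => ny.
  by apply: H; exists y.
have [y1 y2] := K2 _ Ky.
have r2 : r < pi / 2.
  rewrite ltNge; apply/negP => rge; apply: ny; split => //.
  exact: le_trans y2 rge.
split => //.
have py0 : 0 <= dotp p y.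
  by move: y2; rewrite geodist_ler// ?cos_pihalf//; apply/andP; split; lra.
have r0pi : 0 <= r <= pi by rewrite /r; apply/andP; split; move: r2;
  rewrite /r; lra.
have pyr : dotp p y < cos r.
  rewrite ltNge; apply/negP => H; apply: ny; split => //.
  by rewrite geodist_ler.
have yx : dotp (y *m phi) x = dotp p y by rewrite -pphi dotp_phi dotpC.
have sr : 0 < sin r by apply: sin_gt0_pi; move: r2; rewrite /r => ?;
  apply/andP; split; lra.
have [||u [u1 xu uF]] := @direction_of_far_point R _ x (y *m phi) (cos r) (sin
  r) x1 (sphere_phi y1) (cos2Dsin2 r) sr.
- by rewrite yx.
- by rewrite yx.
exists u; split => // z Fz; apply: uF; first exact: F1.
have [_ /(_ z Fz)] := Ky; rewrite geodist_le//; [exact: sphere_phi|exact: F1].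
Qed.

End typical_cell_geometry.

(** * Poisson counts *)

Lemma exp_partial_sum_le (R : realType) (t : R) n : 0 <= t ->
  \sum_(i < n) t ^+ i / i`!%:R <= expR t.
Proof.
move=> t0; rewrite -(big_mkord xpredT (fun i => t ^+ i / i`!%:R)).
have term_ge0 i : 0 <= t ^+ i / i`!%:R by rewrite divr_ge0 ?exprn_ge0.
apply: (nondecreasing_cvgn_le (u_ := series (exp_coeff t)) _ _ n).
  apply/nondecreasing_seqP => k; rewrite /series /= big_nat_recr//= lerDl.
  exact: term_ge0.
exact: is_cvg_series_exp_coeff.
Qed.

(** An index shift turns [k * t ^+ k / k!] into [t] times a term of the exponential series. *)
Lemma poisson_mean_partial_sum_le (R : realType) (t : R) n : 0 <= t ->
  \sum_(k < n) k%:R * (t ^+ k / k`!%:R * expR (- t)) <= t.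
Proof.
move=> t0; case: n => [|n]; first by rewrite big_ord0.
rewrite big_ord_recl mul0r add0r.
rewrite (eq_bigr (fun k : 'I_n => t * expR (- t) * (t ^+ k / k`!%:R))).
  rewrite -mulr_sumr -mulrA; rewrite -[leRHS]mulr1; apply: ler_wpM2l => //.
  rewrite expRN mulrC ler_pdivrMr ?expR_gt0// mul1r.
  exact: exp_partial_sum_le.
move=> k _; rewrite /= /bump leq0n add1n exprS factS natrM.
have k0 : k.+1%:R != 0 :> R by rewrite pnatr_eq0.
have f0 : k`!%:R != 0 :> R by rewrite pnatr_eq0 -lt0n fact_gt0.
move: (k.+1%:R) (k`!%:R) (t ^+ k) (expR _) k0 f0 => u v y z k0 f0.
by field; rewrite k0 f0.
Qed.

Section poisson.
Context {R : realType} {d : nat} {dO : measure_display} {O : measurableType dO}.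
Variables (P : probability O R) (gamma : R) (X : O -> {fset 'rV[R]_d.+1}).
Hypotheses (g0 : 0 < gamma) (PX : isotropic_poisson_process P gamma X).
Implicit Types A B : set (borel 'rV[R]_d.+1).

Definition count_event A k : set O := [set w | points_in (X w) A = k].

Lemma measurable_count A : measurable A ->
  measurable_fun setT (fun w => points_in (X w) A).
Proof. by case: PX => _ H _ _; exact: H. Qed.

Lemma measurable_count_event A k : measurable A -> measurable (count_event A k).
Proof.
move=> mA; rewrite -[X in measurable X]setTI.
exact: (measurable_count mA measurableT (_ : measurable [set k])).
Qed.

Lemma prob_count_event A k : measurable A ->
  P (count_event A k) =
  ((gamma * sph A) ^+ k / k`!%:R * expR (- (gamma * sph A)))%:E.
Proof. by case: PX => _ _ H _; exact: H. Qed.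

Lemma prob_count_eventI A B k l : measurable A -> measurable B ->
  A `&` B = set0 ->
  P (count_event A k `&` count_event B l) =
  (P (count_event A k) * P (count_event B l))%E.
Proof.
move=> mA mB AB; case: PX => _ _ _ /(_ 2%N (fun i => if i == 0 then A else B)
  (fun i => if i == 0 then k else l)) H.
rewrite (_ : _ `&` _ = [set w | forall i : 'I_2, points_in (X w) (if i == 0
  then A else B) =
    if i == 0 then k else l]).
  rewrite H ?big_ord_recl ?big_ord0 ?mule1//; first by move=> i; case: ifP.
  apply/trivIsetP => i j _ _ ij.
  case: ifPn => i0; case: ifPn => j0 //.
  - by move: ij; rewrite (eqP i0) (eqP j0) eqxx.
  - by rewrite setIC.
  have i1 : i = 1 by apply/val_inj; case: i i0 {ij} => [[|[|]]].
  have j1 : j = 1 by apply/val_inj; case: j j0 {ij} => [[|[|]]].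
  by move: ij; rewrite i1 j1 eqxx.
apply/seteqP; split => w /=; first by move=> [? ?] i; case: ifP.
by move=> H'; split; [have := H' 0|have := H' 1].
Qed.

(** The event is split by the number of points in [A]; independence factors each piece, and what is
    left is the mean of a Poisson law. *)
Lemma integral_count_void_le A B : measurable A -> measurable B ->
  A `&` B = set0 ->
  (\int[P]_(w in count_event B 0) (points_in (X w) A)%:R%:E <=
   (gamma * sph A * expR (- (gamma * sph B)))%:E)%E.
Proof.
move=> mA mB AB.
pose E k := count_event A k `&` count_event B 0.
have mE k : measurable (E k) by apply: measurableI; exact: measurable_count_event.
have UE : count_event B 0 = \bigcup_k E k.
  apply/seteqP; split => [w Bw|w [k _ []//]].
  by exists (points_in (X w) A).
have t0 : 0 <= gamma * sph A by rewrite mulr_ge0 ?sph_ge0// ltW.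
have mN : measurable_fun setT (fun w => (points_in (X w) A)%:R%:E : \bar R).
  apply/measurable_EFinP.
  exact: (measurableT_comp (_ : measurable_fun setT (fun n : nat =>
    n%:R : R)) (measurable_count mA)).
rewrite UE ge0_integral_bigcup//; last 2 first.
- exact: (measurable_funS measurableT (@subsetT _ _) mN).
- apply/trivIsetP => i j _ _ ij; apply/seteqP;
  split => // w [[/= Ai _] [/= Aj _]].
  by move: ij; rewrite -Ai -Aj eqxx.
rewrite (eq_eseriesr (g := fun k => (k%:R * ((gamma * sph A) ^+ k / k`!%:R *
  expR (- (gamma * sph A))) * expR (- (gamma * sph B)))%:E)); last first.
  move=> k _; rewrite (eq_integral (cst k%:R%:E)); last first.
    by move=> w; rewrite inE => -[/= -> _].
  rewrite integral_cst//.
  rewrite [X in (_ * X)%E](prob_count_eventI k 0 mA mB AB : _ = _).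
  rewrite !prob_count_event// expr0 fact0 divr1 mul1r.
  by rewrite -!EFinM !mulrA.

apply: lime_le.
  apply: is_cvg_nneseries => k _ _; rewrite lee_fin.
  apply: mulr_ge0; last exact: expR_ge0.
  apply: mulr_ge0 => //; apply: mulr_ge0; last exact: expR_ge0.
  by rewrite divr_ge0 ?exprn_ge0.
near=> n; rewrite big_mkord sumEFin lee_fin -mulr_suml.
by rewrite ler_pM2r ?expR_gt0//; exact: poisson_mean_partial_sum_le.
Unshelve. all: by end_near. Qed.

Lemma prob_single_void A B : measurable A -> measurable B -> A `&` B = set0 ->
  P (count_event A 1 `&` count_event B 0) =
  (gamma * sph A * expR (- (gamma * sph (A `|` B))))%:E.
Proof.
move=> mA mB AB; rewrite prob_count_eventI// !prob_count_event// sphU//.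
rewrite mulrDr opprD expRD -EFinM expr1 expr0 fact0 (_ : 1`! = 1)%N//.
by congr _%:E; rewrite !divr1 mul1r mulrA.
Qed.

Lemma prob_null_hit A : measurable A -> sigma_sphere A = 0%E ->
  P (~` count_event A 0) = 0%E.
Proof.
move=> mA A0; rewrite probability_setC; last exact: measurable_count_event.
by rewrite prob_count_event// /sph A0 /= mulr0 oppr0 expR0 expr0 fact0 divr1
  mulr1 subee.
Qed.

End poisson.

(** * Bounds for the law of the typical cell *)

Section points_in_theory.
Context {R : realType} {d : nat}.
Implicit Types (F : {fset 'rV[R]_d.+1}) (A : set 'rV[R]_d.+1).

Lemma points_in_sum F A : points_in F A = (\sum_(x <- F) (x \in A))%N.
Proof.
rewrite /points_in -sum1_size -big_fset_condE big_mkcond.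
by apply: eq_bigr => x _; case: (x \in A).
Qed.

Lemma points_in_eq0 F A : points_in F A = 0%N <-> forall x, x \in F -> ~ A x.
Proof.
rewrite /points_in; split => [/cardfs0_eq F0 x xF Ax|H].
  suff : x \in fset0 by rewrite inE.
  by rewrite -F0 !inE/= xF mem_set.
apply/eqP; rewrite cardfs_eq0; apply/eqP/fsetP => x; rewrite !inE/=.
by apply/negP => /andP[xF /set_mem]; exact: H.
Qed.

Lemma points_in_eq1 F A : points_in F A = 1%N ->
  exists x, [/\ x \in F, A x & forall z, z \in F -> A z -> z = x].
Proof.
rewrite /points_in => /eqP/cardfs1P[x xE]; exists x.
have : x \in [fset x]%fset by rewrite inE.
rewrite -xE !inE/= => /andP[xF /set_mem Ax]; split => // z zF Az.
have : z \in [fset y in F | y \in A]%fset by rewrite !inE/= zF mem_set.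
by rewrite xE inE => /eqP.
Qed.

End points_in_theory.

(** * Sets of rotations and integrals over them *)

Section rotation_sets.
Context {R : realType} {n : nat}.

Let measurable_mx_eq d (T : measurableType d) m k (f : T -> 'M[R]_(m,
  k)) (c : 'M[R]_(m, k)) :
  (forall i j, measurable_fun setT (fun t => f t i j)) ->
  measurable [set t | f t = c].
Proof.
move=> mf.
rewrite (_ : [set t | _] = \bigcap_(ij : 'I_m * 'I_k) ((fun t => f t ij.1 ij.2)
  @^-1` [set c ij.1 ij.2])).
  apply: (@fin_bigcap_measurable _ T) => [|ij _]; first exact: finite_finset.
  by rewrite -[X in measurable X]setTI; exact: mf.
apply/seteqP; split => t /= H; first by move=> ij _ /=; rewrite H.
by apply/matrixP => i j; exact: H (i, j) I.
Qed.

Let entry (i j : 'I_n) : measurable_fun setT (fun phi : borel 'M[R]_n =>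
  (phi i j : R)).
Proof. exact: measurable_entry. Qed.

Lemma measurable_SO : measurable (@SO R n : set (borel 'M[R]_n)).
Proof.
apply: measurableI.
  apply: measurable_mx_eq => i j.
  rewrite (_ : (fun _ => _) = fun phi : borel 'M[R]_n => \sum_k (phi i k : R) *
    (phi j k : R)); last first.
    by apply/funext => phi; rewrite mxE; apply: eq_bigr => k _; rewrite mxE.
  apply: measurable_sum => k; exact: (measurable_funM (entry i k) (entry j k)).
have m : measurable_fun setT (fun phi : borel 'M[R]_n => \det phi : R).
  apply: (@measurable_sum _ (borel 'M[R]_n) R setT) => s.
  apply: (measurable_funM (measurable_cst _)).
  by apply: (@measurable_prod _ (borel 'M[R]_n) R setT) => i _; exact: entry.
by have := m measurableT _ (measurable_set1 (1 : R)); rewrite setTI.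
Qed.

Definition rotations_to (p x : 'rV[R]_n) : set 'M[R]_n :=
  [set phi | SO phi /\ p *m phi = x].

Lemma measurable_rotations_to p x :
  measurable (rotations_to p x : set (borel 'M[R]_n)).
Proof.
apply: measurableI; first exact: measurable_SO.
apply: measurable_mx_eq => i j.
rewrite (_ : (fun _ => _) = fun phi : borel 'M[R]_n => \sum_k p i k * (phi k j
  : R)); last first.
  by apply/funext => phi; rewrite mxE.
apply: measurable_sum => k; exact: (measurable_funM (measurable_cst (p i k))
  (entry k j)).
Qed.

End rotation_sets.

Section rotation_integral.
Context {R : realType} {n : nat}.
Variables (k : {measure set (borel 'M[R]_n) -> \bar R}) (p x : 'rV[R]_n).
Hypotheses (k1 : k setT = 1%E) (kx : k (~` rotations_to p x) = 0%E).
Variable f : 'M[R]_n -> bool.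

Let I := (\int[k]_(phi in @SO R n) (f phi)%:R%:E)%E.

Let mr := measurable_rotations_to p x.

Lemma rotation_integral_le1 : (I <= 1)%E.
Proof.
apply: (@le_trans _ _ (\int[k]_(phi in @SO R n) cst 1 phi)%E).
  by apply: le_integral_nonneg => phi _; rewrite lee_fin//; case: (f phi).
rewrite integral_cst ?mul1e; last exact: measurable_SO.
by rewrite -k1; apply: le_measure; rewrite ?inE//; exact: measurable_SO.
Qed.

(** Since [f] may be non-measurable, it is dominated by the indicator of a measurable null set. *)
Lemma rotation_integral_eq0 : (forall phi, rotations_to p x phi -> ~~ f phi) ->
  I = 0%E.
Proof.
move=> f0; apply/eqP; rewrite eq_le; apply/andP; split; last first.
  by apply: integral_ge0 => phi _; rewrite lee_fin.
apply: (@le_trans _ _ (\int[k]_(phi in @SO R n) (\1_(~` rotations_to p x)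
  phi)%:E)%E).
  apply: le_integral_nonneg => phi _; first by rewrite lee_fin.
  rewrite lee_fin indicE; case: (boolP (f phi)) => //= fphi.
  by rewrite mem_set//= => /f0; rewrite fphi.
rewrite integral_indic; [|exact: measurable_SO|exact: measurableC].
rewrite -kx; apply: le_measure; rewrite ?inE//.
- by apply: measurableI; [exact: measurableC|exact: measurable_SO].
- exact: measurableC.
Qed.

Lemma rotation_integral_ge1 : (forall phi, rotations_to p x phi -> f phi) ->
  (1 <= I)%E.
Proof.
move=> f1.
apply: (@le_trans _ _ (\int[k]_(phi in @SO R n) (\1_(rotations_to p x)
  phi)%:E)%E); last first.
  apply: le_integral_nonneg => phi _; first by rewrite lee_fin.
  by rewrite lee_fin indicE; case: (boolP (_ \in _)) => //= /set_mem /f1 ->.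
rewrite integral_indic; [|exact: measurable_SO|exact: mr].
rewrite (_ : _ `&` _ = rotations_to p x); last by apply/setIidl => phi [].
rewrite -k1 -(setUv (rotations_to p x)) measureU0//; exact: measurableC.
Qed.

End rotation_integral.

Section typical_cell_bounds.
Context {R : realType} {d : nat} {dO : measure_display} {O : measurableType dO}.
Variables (P : probability O R) (gamma : R) (X : O -> {fset 'rV[R]_d.+1}).
Variables (p : 'rV[R]_d.+1)
  (kappa : R.-pker (borel 'rV[R]_d.+1) ~> (borel 'M[R]_d.+1)).
Hypotheses (g0 : 0 < gamma) (PX : isotropic_poisson_process P gamma X).
Hypothesis kappaP : rotation_kernel p kappa.

(** The kernel is controlled only at almost every [x], but the exceptional points lie in a null set,
    which [X] misses almost surely. *)
Let exceptional_event : exists N : set O, [/\ measurable N, P N = 0%E &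
  forall w x, ~ N w -> x \in X w -> kappa x (~` rotations_to p x) = 0%E].
Proof.
case: kappaP => _ [A [mA A0 Abad]].
exists (~` count_event X A 0); split.
- by apply: measurableC; exact: (measurable_count_event PX).
- exact: (prob_null_hit PX).
move=> w x /contrapT /points_in_eq0 NA xX.
by apply: contrapT => kx; apply: (NA x xX); exact: Abad.
Qed.

Let cell_integral (E : set (set 'rV[R]_d.+1)) w x : \bar R :=
  \int[kappa x]_(phi in @SO R d.+1)
    (\1_E (mulmxr phi @^-1` voronoi_cell x [set` X w]))%:E.

Let cell_integral_ge0 E w x : (0 <= cell_integral E w x)%E.
Proof. by apply: integral_ge0 => phi _; rewrite lee_fin. Qed.

Let Xsphere w x : x \in X w -> sphere x.
Proof. by case: PX => H _ _ _; exact: H. Qed.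

Variables (I : finType) (Q : pred I).
Variables (A B : I -> set (borel 'rV[R]_d.+1)).
Hypotheses (mA : forall i, measurable (A i)) (mB : forall i, measurable (B i)).
Hypothesis AB : forall i, A i `&` B i = set0.

(** Each nucleus whose cell can fall in [E] is counted by some [A i] with [B i] void, and
    [integral_count_void_le] bounds the mean of these counts. *)
Lemma typical_cell_law_le (E : set (set 'rV[R]_d.+1)) :
  (forall w x phi, x \in X w -> rotations_to p x phi ->
     E (mulmxr phi @^-1` voronoi_cell x [set` X w]) ->
     exists i, [/\ Q i, A i x & points_in (X w) (B i) = 0%N]) ->
  (typical_cell_law P gamma X kappa E <=
   (\sum_(i | Q i) sph (A i) * expR (- (gamma * sph (B i))))%:E)%E.
Proof.
move=> EAB; have [N [mN PN0 Nk]] := exceptional_event.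
pose f i w : \bar R := ((fun w => (points_in (X w) (A i))%:R%:E) \_
  (count_event X (B i) 0)) w.
(* On the null event [N] the integrand is bounded by infinity, at no cost. *)
pose bad w : \bar R := (cst +oo%E \_ N) w.
have mf i : measurable_fun setT (f i).
  apply/(measurable_restrictT _ (measurable_count_event PX 0%N (mB i))).
  apply: (measurable_funS measurableT (@subsetT _ _)); apply/measurable_EFinP.
  exact: (measurableT_comp (_ : measurable_fun setT (fun n : nat =>
    n%:R : R)) (measurable_count PX (mA i))).
have mbad : measurable_fun setT bad.
  by apply/(measurable_restrictT _ mN); exact: measurable_cst.
have f0 i w : (0 <= f i w)%E by rewrite /f /patch; case: ifP => // _;
  rewrite lee_fin.
have bad0 w : (0 <= bad w)%E by rewrite /bad /patch; case: ifP => // _;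
  rewrite /cst leey.
have msum : measurable_fun setT (fun w => \sum_(i | Q i) f i w)%E.
  rewrite (_ : (fun _ => _) = fun w => (\sum_(i <- enum Q) f i w)%E).
    by apply: emeasurable_sum => i; exact: mf.
  by apply/funext => w; rewrite big_enum.
apply: (@le_trans _ _ (gamma^-1%:E * \int[P]_w (\sum_(i | Q i) f i w + bad w))%E).
  rewrite /typical_cell_law; apply: lee_wpmul2l;
    first by rewrite lee_fin invr_ge0 ltW.
  apply: le_integral_nonneg => w _; first by apply: sume_ge0 => x _;
    exact: cell_integral_ge0.
  have [Nw|Nw] := pselect (N w).
    rewrite [bad w](_ : _ = +oo%E); last by rewrite /bad /patch mem_set.
    by rewrite addey ?leey// gt_eqF// (@lt_le_trans _ _ 0%E) ?ltNy0// sume_ge0.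
  rewrite [bad w](_ : _ = 0%E) ?adde0; last by rewrite /bad /patch memNset.
  have fE i : f i w = (\sum_(x <- X w) ((x \in A i) && (points_in (X w) (B i)
    == 0%N))%:R%:E)%E.
    rewrite sumEFin -natr_sum /f /patch; case: ifPn => [/set_mem/= ->|].
      by rewrite eqxx points_in_sum; congr (_%:R%:E); apply: eq_bigr => x _;
        rewrite andbT.
    rewrite notin_setE /= => /eqP/negPf ->.
    by rewrite big1// => x _; rewrite andbF.
  rewrite (eq_bigr _ (fun i _ => fE i)) exchange_big/=.
  rewrite big_seq [leRHS]big_seq; apply: lee_sum => x xX.
  have k0 := Nk w x Nw xX.
  have k1 : kappa x setT = 1%E by exact: prob_kernel.
  have rhs0 i : Q i -> (0 <= ((x \in A i) && (points_in (X w) (B i) ==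
    0%N))%:R%:E :> \bar R)%E.
    by rewrite lee_fin.
  have [[phi [phix Ephi]]|noE] := pselect (exists phi, rotations_to p x phi /\
      E (mulmxr phi @^-1` voronoi_cell x [set` X w])).
    have [i [Qi Ai Bi]] := EAB w x phi xX phix Ephi.
    apply: (@le_trans _ _ 1%E).
      exact: (rotation_integral_le1 k1 (fun phi => mulmxr phi @^-1`
        voronoi_cell x [set` X w] \in E)).
    rewrite (bigD1 i)//= mem_set// Bi eqxx/=.
    by rewrite leeDl// sume_ge0// => j /andP[/rhs0].
  apply: (@le_trans _ _ 0%E); last by apply: sume_ge0.
  rewrite [leLHS](_ : _ = 0%E)//.
  apply: (rotation_integral_eq0 k0 (f := fun phi => mulmxr phi @^-1`
    voronoi_cell x [set` X w] \in E)).
  by move=> phi phix; apply/negP => /set_mem Ephi; apply: noE; exists phi.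
rewrite ge0_integralD//; last by move=> w _; apply: sume_ge0.
have -> : (\int[P]_w bad w = 0)%E.
  by rewrite -integral_mkcond integral_cst// [X in (_ * X)%E](PN0 : _ = _) mule0.
rewrite adde0.
under eq_integral do rewrite -big_enum.
rewrite ge0_integral_sum// big_enum/=.
apply: (@le_trans _ _ (gamma^-1%:E * \sum_(i | Q i) (gamma * sph (A i) * expR
  (- (gamma * sph (B i))))%:E)%E).
  apply: lee_wpmul2l; first by rewrite lee_fin invr_ge0 ltW.
  apply: lee_sum => i _; rewrite -integral_mkcond.
  exact: (integral_count_void_le g0 PX (mA i) (mB i) (AB i)).
rewrite sumEFin -EFinM lee_fin mulr_sumr; apply: ler_sum => i _.
by rewrite !mulrA mulVf ?gt_eqF// mul1r.
Qed.

(** On the event of exactly one point in [A i] and none in [B i], that point contributes a full 1,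
    up to a null event. *)
Lemma typical_cell_law_ge (E : set (set 'rV[R]_d.+1)) :
  (forall i j x, A i x -> A j x -> i = j) ->
  (forall w x phi i, Q i -> x \in X w -> A i x ->
     (forall z, z \in X w -> A i z -> z = x) ->
     points_in (X w) (B i) = 0%N -> rotations_to p x phi ->
     E (mulmxr phi @^-1` voronoi_cell x [set` X w])) ->
  ((\sum_(i | Q i) sph (A i) * expR (- (gamma * sph (A i `|` B i))))%:E <=
   typical_cell_law P gamma X kappa E)%E.
Proof.
move=> Adisj ABE; have [N [mN PN0 Nk]] := exceptional_event.
pose V i := (count_event X (A i) 1 `&` count_event X (B i) 0) `\` N.
have mC i : measurable (count_event X (A i) 1 `&` count_event X (B i) 0).
  by apply: measurableI; exact: (measurable_count_event PX).
have mV i : measurable (V i) by exact: measurableD.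
have PV i : P (V i) = (gamma * sph (A i) * expR (- (gamma * sph (A i `|` B
  i))))%:E.
  rewrite -(prob_single_void PX (mA i) (mB i) (AB i)).
  apply/eqP; rewrite eq_le; apply/andP; split.
    by apply: le_measure; rewrite ?inE//; exact: subDsetl.
  rewrite -[leRHS](measureU0 (mV i) mN PN0).
  apply: le_measure; rewrite ?inE//; first exact: measurableU.
  by move=> w Cw; have [Nw|Nw] := pselect (N w); [right|left].
apply: (@le_trans _ _ (gamma^-1%:E * \int[P]_w (\sum_(i | Q i) (\1_(V i)
  w)%:E))%E).
  under eq_integral do rewrite -big_enum.
  rewrite ge0_integral_sum//; last by move=> i; apply/measurable_EFinP.
  rewrite big_enum/= (eq_bigr (fun i => P (V i))); last by move=> i _;
    rewrite integral_indic// setIT.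
  rewrite (eq_bigr _ (fun i _ => PV i)) sumEFin -EFinM lee_fin mulr_sumr.
  by apply: ler_sum => i _; rewrite !mulrA mulVf ?gt_eqF// mul1r.
rewrite /typical_cell_law; apply: lee_wpmul2l;
  first by rewrite lee_fin invr_ge0 ltW.
apply: le_integral_nonneg => w _; first by apply: sume_ge0 => i _;
  rewrite lee_fin.
have [Nw|Nw] := pselect (N w).
  rewrite big1 => [|i _]; first by apply: sume_ge0 => x _;
    exact: cell_integral_ge0.
  by rewrite indicE memNset// => -[].
(* Each event is charged to its nucleus; as the [A i] are disjoint, no nucleus is charged twice. *)
apply: (@le_trans _ _ (\sum_(x <- X w) \sum_(i | Q i) (x \in A i)%:R%:E *
  cell_integral E w x)%E).
  rewrite exchange_big/=; apply: lee_sum => i Qi.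
  rewrite indicE; have [/set_mem[[A1 B0] _]|_] := boolP (w \in V i); last first.
    by apply: sume_ge0 => x _; rewrite mule_ge0 ?lee_fin.
  have [x [xX Ax xuniq]] := points_in_eq1 A1.
  rewrite (big_rem x)//= mem_set// mul1e;
    apply: (@le_trans _ _ (cell_integral E w x)).
    have k1 : kappa x setT = 1%E by exact: prob_kernel.
    apply: (rotation_integral_ge1 k1 (Nk w x Nw xX)
      (f := fun phi => mulmxr phi @^-1` voronoi_cell x [set` X w] \in E)).
    by move=> phi phix; apply/mem_set; exact: (ABE w x phi i Qi xX Ax xuniq B0
      phix).
  rewrite leeDl//; apply: sume_ge0 => z _.
  by apply: mule_ge0; [rewrite lee_fin|exact: cell_integral_ge0].
apply: lee_sum => x _; rewrite -ge0_sume_distrl; last by move=> i _;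
  rewrite lee_fin.
rewrite -[leRHS]mul1e; apply: lee_wpmul2r; first exact: cell_integral_ge0.
have [[i [Qi Ai]]|noA] := pselect (exists i, Q i /\ A i x).
  rewrite (bigD1 i)//= mem_set// big1 ?adde0// => j /andP[_ ji].
  by rewrite memNset// => Aj; move: ji; rewrite (Adisj _ _ _ Aj Ai) eqxx.
rewrite big1// => i Qi; rewrite memNset// => Ai.
by apply: noA; exists i.
Qed.

End typical_cell_bounds.

(** * Discretization *)

(** Half-open cubes of side [h]; the Euclidean norm is at most the sum of the [d.+1] coordinates. *)
Lemma grid_partition (R : realType) d (delta : R) : 0 < delta ->
  exists (I : finType) (A : I -> set (borel 'rV[R]_d.+1)),
  [/\ forall i, measurable (A i),
      forall i x y, A i x -> A i y -> enorm (x - y) <= delta,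
      forall i j x, A i x -> A j x -> i = j &
      forall x, sphere x -> exists i, A i x].
Proof.
move=> delta0; pose h := delta / d.+1%:R.
have h0 : 0 < h by rewrite divr_gt0.
(* [M] intervals of length [h] starting at -1 reach strictly past 1, so the coordinate 1 is covered
   too. *)
pose M := (Num.truncn (2 / h)).+1.
pose cell (f : {ffun 'I_d.+1 -> 'I_M}) : set (borel 'rV[R]_d.+1) :=
  [set x | forall i, (f i)%:R * h - 1 <= x 0 i < (f i).+1%:R * h - 1].
exists {ffun 'I_d.+1 -> 'I_M}, cell; split.
- move=> f; rewrite (_ : cell f = \bigcap_(i : 'I_d.+1)
     ((fun x : borel 'rV[R]_d.+1 => (x 0 i : measurableTypeR R)) @^-1`
        `[(f i)%:R * h - 1, (f i).+1%:R * h - 1[)).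
    apply: (@fin_bigcap_measurable _ (borel 'rV[R]_d.+1)) => [|i _];
      first exact: finite_finset.
    rewrite -[X in measurable X]setTI.
    exact: (measurable_entry (0 : 'I_1) i measurableT (measurable_itv _)).
  apply/seteqP; split => x /= H i; first by move=> _ /=; rewrite in_itv/=;
    exact: H.
  by have := H i I; rewrite /= in_itv.
- move=> f x y fx fy; apply: le_trans (enorm_le_sum _) _.
  have xy j : `|(x - y) 0 j| <= h.
    rewrite !mxE ler_norml; have := fx j; have := fy j; rewrite -!natr1.
    by move=> /andP[? ?] /andP[? ?]; apply/andP; split; lra.
  apply: le_trans (ler_sum _ (fun j _ => xy j)) _.
  by rewrite sumr_const card_ord -[_ *+ d.+1]mulr_natr divfK.
- move=> f g x fx gx; apply/ffunP => i; apply/val_inj/eqP.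
  have lef (f1 f2 : {ffun 'I_d.+1 -> 'I_M}) : cell f1 x -> cell f2 x ->
    (f1 i <= f2 i)%N.
    move=> /(_ i)/andP[a1 _] /(_ i)/andP[_ a2].
    rewrite -ltnS -(ltr_nat R) -(ltr_pM2r h0).
    by have := le_lt_trans a1 a2; rewrite ltrD2r.
  by rewrite eqn_leq !lef.
- move=> x x1.
  have xi i : 0 <= (x 0 i + 1) / h /\ (Num.truncn ((x 0 i + 1) / h)%R < M)%N.
    have := normr_coord_le x i; rewrite (_ : enorm x = 1);
      last by rewrite -sphereE.
    rewrite ler_norml => /andP[x0 x2].
    have q0 : 0 <= (x 0 i + 1) / h by apply: divr_ge0; [lra|exact: ltW].
    split => //; rewrite ltnS; apply: le_truncn.
    by rewrite ler_pM2r ?invr_gt0//; lra.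
  exists [ffun i => inord (Num.truncn ((x 0 i + 1) / h))] => i.
  have [q0 qM] := xi i; rewrite ffunE inordK//.
  have /andP[q1 q2] := truncn_itv q0.
  have : x 0 i = (x 0 i + 1) / h * h - 1 by rewrite divfK ?gt_eqF//; ring.
  move: {q0 qM} q1 q2; move: ((x 0 i + 1) / h) => q q1 q2 ->.
  by rewrite lerD2r ltrD2r ler_pM2r// q1 ltr_pM2r.
Qed.

(** * Comparison of the void regions *)

Section exponent_gap.
Context {R : realType} {d : nat}.

(** The caps and lenses below are sets of the whole space, of which [sph] sees only the trace on the
    sphere. *)
Lemma le_sph_sphere (A B : set (borel 'rV[R]_d.+1)) : measurable A ->
  measurable B ->
  (forall z, sphere z -> A z -> B z) -> sph A <= sph B.
Proof.
move=> mA mB AB; rewrite !sphE// ler_pM2r ?invr_gt0 ?ball_volume_gt0//.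
apply: fine_le; [exact: volume_pcone_fin|exact: volume_pcone_fin|].
apply: le_volume; [exact: measurable_pcone|exact: measurable_pcone|].
move=> v [/andP[v0 v1] Av]; split; first by rewrite v0.
by apply: AB => //; exact: sphere_normalize.
Qed.

Lemma measurable_dotpr (x : 'rV[R]_d.+1) : measurable_fun setT (fun z : borel
  'rV[R]_d.+1 => dotp x z).
Proof.
exact: (measurable_dotp (measurable_cst (x : borel 'rV[R]_d.+1))
  (@measurable_id _ (borel 'rV[R]_d.+1) setT)).
Qed.

Lemma normr_dotp_diff (x y z : 'rV[R]_d.+1) : sphere z ->
  `|dotp x z - dotp y z| <= enorm (x - y).
Proof.
move=> z1; rewrite -dotpNl -dotpDl; apply: le_trans (normr_dotp_le _ _) _.
by rewrite (_ : enorm z = 1) ?mulr1// -sphereE.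
Qed.

(* With [t = cos (2 * a)]: the points [z] that violate [dotp x' z <= t] or
   [dotp u' z <= k * (1 - dotp x' z)] for every [x'] and [u'] at distance at most
   [delta] from [x] and [u]; the part of the second kind outside the cap around
     [x]
   is the lens. *)
Definition void_region (t k delta : R) (x u : 'rV[R]_d.+1) : set (borel
  'rV[R]_d.+1) :=
  [set z | t + delta < dotp x z] `|`
  [set z | dotp x z <= t /\ k * (1 - dotp x z) + (1 + k) * delta < dotp u z].

Definition cap_ge (t : R) (x : 'rV[R]_d.+1) : set (borel 'rV[R]_d.+1) :=
  [set z | t <= dotp x z].

Lemma measurable_cap_ge t x : measurable (cap_ge t x).
Proof.
have := measurable_dotpr x measurableT (measurable_itv `[t, +oo[).
rewrite setTI (_ : _ @^-1` _ = cap_ge t x)//.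
by apply/seteqP; split => z; rewrite /cap_ge /= in_itv/= andbT.
Qed.

Lemma measurable_cap_gt t x : measurable ([set z | t < dotp x z] : set (borel
  'rV[R]_d.+1)).
Proof.
have := measurable_dotpr x measurableT (measurable_itv `]t, +oo[).
rewrite setTI (_ : _ @^-1` _ = [set z | t < dotp x z])//.
by apply/seteqP; split => z; rewrite /= in_itv/= andbT.
Qed.

Lemma measurable_zone s t x :
  measurable ([set z | s <= dotp x z <= t] : set (borel 'rV[R]_d.+1)).
Proof.
have := measurable_dotpr x measurableT (measurable_itv `[s, t]).
by rewrite setTI.
Qed.

Lemma measurable_lens t k c x u : measurable
  ([set z | dotp x z <= t /\ k * (1 - dotp x z) + c < dotp u z] : set (borel
    'rV[R]_d.+1)).
Proof.
apply: measurableI.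
  rewrite (_ : (fun z => _) = ~` [set z : borel 'rV[R]_d.+1 | t < dotp x z]);
    first by apply: measurableC; exact: measurable_cap_gt.
  by apply/seteqP; split => z /=; rewrite leNgt => /negP.
rewrite (_ : (fun z => _) = [set z : borel 'rV[R]_d.+1 | k + c < dotp (u + k *:
  x) z]).
  exact: measurable_cap_gt.
by apply/seteqP; split => z /=; rewrite dotpDl dotpZl; lra.
Qed.

Lemma measurable_void_region t k delta x u : measurable (void_region t k delta
  x u).
Proof. by apply: measurableU;
  [exact: measurable_cap_gt|exact: measurable_lens]. Qed.

End exponent_gap.

(** The lens contributes at least [s], of order [Num.sqrt eps ^+ d.+2]. Removing [A], and exchanging
    the cap around [xj] for the smaller one around [x0], costs only order [delta], made at most
    [s / 2]; hence [beta] is half the lens constant and independent of [eps]. *)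
Lemma exponent_gap (R : realType) d (a : R) : 0 < a < pi / 2 ->
  exists2 beta : R, 0 < beta & forall eps, 0 < eps <= 1 -> a + eps / 2 < pi / 2 ->
  exists2 delta : R, 0 < delta &
  forall (x0 u0 xj : 'rV[R]_d.+2) (A : set (borel 'rV[R]_d.+2)),
    sphere x0 -> sphere u0 -> dotp x0 u0 = 0 -> measurable A ->
    (forall z, A z -> enorm (z - x0) <= delta) -> enorm (xj - x0) <= delta ->
    sph (A `|` cap_ge (cos (2 * a) - delta) xj) + beta * Num.sqrt eps ^+ d.+2 <=
    sph (void_region (cos (2 * a)) (cos (a + eps / 2) / sin (a + eps / 2))
      delta x0 u0 `\` A).
Proof.
move=> a_itv; have /andP[a0 a2] := a_itv; have pi0 := pi_gt0 R.
have ca : 0 < cos a by apply: cos_gt0_pihalf; apply/andP; split; lra.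
have sa : 0 < sin a by apply: sin_gt0_pi; apply/andP; split; lra.
pose T0 := sin a / cos a.
have T00 : 0 < T0 by rewrite divr_gt0.
have iT00 : 0 < T0^-1 by rewrite invr_gt0.
have [c3 c30 gap] := cot_gap a_itv; rewrite -/T0 in gap.
have [b b0 [g g0 lens]] := sph_lens d T00 c30.
pose t := cos (2 * a).
have tE : t = (1 - T0 ^+ 2) / (1 + T0 ^+ 2) by exact: cos_double_tan.
have t1 : `|t| < 1.
  rewrite ltr_norml -(@cospi R) -(@cos0 R) /t; apply/andP; split;
    by rewrite ltr_cos ?in_itv/=; [lra|apply/andP; split; lra|apply/andP;
      split; lra].
have z1 : `|0 : R| < 1 by rewrite normr0.
have [C1 C10 band1] := sph_band (d := d.+1) t1.
have [C0 C00 band0] := sph_band (d := d.+1) z1.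
rewrite -/t; clearbody T0 t.
exists (b / 2); first by rewrite divr_gt0.
move=> eps eps01 r2; have /andP[e0 e1] := eps01.
have := gap _ eps01 r2; set k := cos _ / sin _ => kgap.
have k0 : 0 <= k.
  move: a0 e0 r2 pi0; clear => a0 e0 r2 pi0.
  by apply: divr_ge0; [apply: cos_ge0_pihalf|apply: sin_ge0_pi]; apply/andP;
    split; lra.
clearbody k.
pose s := b * Num.sqrt eps ^+ d.+2.
have s0 : 0 < s by apply: mulr_gt0 => //; rewrite exprn_gt0// sqrtr_gt0.
have -> : b / 2 * Num.sqrt eps ^+ d.+2 = s / 2 by rewrite /s; ring.
have C0' : 0 < 4 * (C0 + C1) by lra.
have k1T : 0 < 1 + T0^-1 by lra.
(* The first two bounds admit [sph_band] for the zone [D] and for [A], the third keeps the shift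
   [(1 + k) * delta] within the range of [sph_lens], the fourth limits the total loss. *)
pose delta := Num.min (Num.min ((1 - `|t|) / 6) (1 / 3))
  (Num.min (g * eps / (1 + T0^-1)) (s / (4 * (C0 + C1)))).
have delta0 : 0 < delta.
  rewrite /delta !lt_min !divr_gt0// ?mulr_gt0//; lra.
have [d1 d2 d3 d4] : [/\ delta <= (1 - `|t|) / 6, delta <= 1 / 3,
    delta * (1 + T0^-1) <= g * eps & delta * (4 * (C0 + C1)) <= s].
  rewrite -!ler_pdivlMr// /delta; split; rewrite !ge_min !lexx ?orbT//.
clearbody delta.
have kT : k <= T0^-1.
  by apply: le_trans kgap _; rewrite gerBl; apply: mulr_ge0; exact: ltW.
exists delta => // x0 u0 xj A x01 u01 xu mA Ax Axj.
set U1 : set (borel 'rV[R]_d.+2) := [set z | t + delta < dotp x0 z].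
set U2 : set (borel 'rV[R]_d.+2) := [set z | dotp x0 z <= t /\ k * (1 - dotp x0
  z) + (1 + k) * delta < dotp u0 z].
have mU2 : measurable U2 by exact: measurable_lens.
have mU : measurable (U1 `|` U2) by exact: measurable_void_region.
rewrite (_ : void_region t k delta x0 u0 = U1 `|` U2) //.
have mU1 : measurable U1 by exact: measurable_cap_gt.
set D : set (borel 'rV[R]_d.+2) := [set z | t - 2 * delta <= dotp x0 z <= t + 2
  * delta].
have mD : measurable D by exact: measurable_zone.
have U12 : U1 `&` U2 = set0.
  apply/seteqP; split => // z [H1 [H2 _]].
  have H : t + delta < dotp x0 z by exact: H1.
  by have := lt_le_trans H H2; rewrite gtrDl ltNge ltW.
have sphU2 : s <= sph U2.
  apply: (lens eps k ((1 + k) * delta) x0 u0 eps01 _ _ x01 u01 xu U2 mU2).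
  - by rewrite k0.
  - apply/andP; split; first by apply: mulr_ge0; [rewrite addr_ge0|exact: ltW].
    apply: le_trans d3; rewrite mulrC; apply: ler_wpM2l; first exact: ltW.
    by rewrite lerD2l.
  - by rewrite -tE => z z_1 H1 H2; split.
have dd0 : 0 < 2 * delta by rewrite mulr_gt0.
have dd1 : 2 * delta <= (1 - `|t|) / 3 by move: d1; clear; lra.
have sphD : sph D <= C1 * (2 * delta).
  apply: (band1 x0 (2 * delta) x01 dd0 dd1 D mD) => z _ /andP[].
  rewrite ler_norml; move: (dotp x0 z) => q; clear => ? ?.
  by apply/andP; split; lra.
have dd2 : delta <= (1 - `|0 : R|) / 3 by rewrite normr0 subr0.
(* As [u0] is orthogonal to [x0], the small set [A] lies in a thin zone around the equator of
   [u0]. *)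
have sphA : sph A <= C0 * delta.
  apply: (band0 u0 delta u01 delta0 dd2 A mA) => z _ Az; rewrite subr0.
  have -> : dotp u0 z = dotp u0 (z - x0) by rewrite dotpDr dotpNr (dotpC u0 x0)
    xu subr0.
  apply: le_trans (normr_dotp_le _ _) _.
  rewrite (_ : enorm u0 = 1); last by rewrite -sphereE.
  by rewrite mul1r; exact: Ax.
have mB : measurable (cap_ge (t - delta) xj) by exact: measurable_cap_ge.
have sphB : sph (cap_ge (t - delta) xj) <= sph U1 + sph D.
  apply: le_trans (sph_subadd mU1 mD).
  apply: (le_sph_sphere mB (measurableU _ _ mU1 mD)) => z z_1 Hz.
  have {}Hz : t - delta <= dotp xj z by exact: Hz.
  have := normr_dotp_diff xj x0 z_1 => /le_trans/(_ Axj);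
    rewrite ler_norml => /andP[H1 H2].
  have [H3|H3] := ltP (t + delta) (dotp x0 z); first by left.
  right; move: Hz H1 H2 H3 delta0; rewrite /D /=;
    move: (dotp x0 z) (dotp xj z) => q r.
  by clear=> ? ? ? ? ?; apply/andP; split; lra.
apply: le_trans (sphD_ge mU mA).
rewrite (sphU mU1 mU2 U12).
have H1 := sph_subadd mA mB.
have H2 : delta * (4 * (C0 + C1)) = 4 * (C0 * delta) + 2 * (C1 * (2 * delta))
  by ring.
move: H1 H2 sphB sphA sphD sphU2 d4.
move: (sph _) (sph U1) (sph U2) (sph D) (sph A) (sph _) => v1 v2 v3 v4 v5 v6.
by clear; lra.
Qed.

(** * The conditional probability *)

(* Since [fine +oo = 0] and [r / 0 = 0], an infinite or zero [y] is harmless. *)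
Lemma fine_div_le (R : realType) (x y : \bar R) (q l C : R) :
  (x <= q%:E)%E -> (l%:E <= y)%E -> 0 <= q -> 0 <= l -> 0 <= C -> q <= C * l ->
  fine x / fine y <= C.
Proof.
move=> xq ly q0 l0 C0 qCl.
have {}xq : fine x <= q by move: x xq => [r| |]//=; rewrite leye_eq.
move: y ly => [r| |]//=; last by rewrite invr0 mulr0.
rewrite lee_fin => lr; have r0 := le_trans l0 lr.
have [->|rn0] := eqVneq r 0; first by rewrite invr0 mulr0.
rewrite ler_pdivrMr ?lt_def ?rn0//.
by apply: le_trans xq (le_trans qCl _); exact: ler_wpM2l.
Qed.

Lemma powR_half_natr (R : realType) (x : R) n : 0 <= x ->
  x `^ (n%:R / 2) = Num.sqrt x ^+ n.
Proof. by move=> x0; rewrite mulrC powRrM powR12_sqrt// powR_mulrn ?sqrtr_ge0.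
  Qed.

Section typical_cell_deviation.
Context {R : realType} {d : nat}.
Variables (a eps : R).
Hypotheses (a_itv : 0 < a < pi / 2) (eps01 : 0 < eps <= 1).
Variables (dO : measure_display) (O : measurableType dO) (P : probability O R).
Variables (gamma : R) (p : 'rV[R]_d.+2) (X : O -> {fset 'rV[R]_d.+2}).
Variable kappa : R.-pker (borel 'rV[R]_d.+2) ~> (borel 'M[R]_d.+2).
Hypotheses (g0 : 0 < gamma) (p1 : sphere p).
Hypotheses (PX : isotropic_poisson_process P gamma X) (kappaP : rotation_kernel
  p kappa).

Let deviation := [set K | convex_bodies_at p K /\ eps <= vartheta p K].
Let large := [set K | a <= inradius p K].
Let law := typical_cell_law P gamma X kappa.

Let Xsphere w : [set` X w] `<=` @sphere R d.+1.
Proof. by move=> x; case: PX => H _ _ _; exact: H. Qed.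

Let k := cos (a + eps / 2) / sin (a + eps / 2).
Let t := cos (2 * a).

Let deviation_geometry w x phi : x \in X w -> rotations_to p x phi ->
  (deviation `&` large) (mulmxr phi @^-1` voronoi_cell x [set` X w]) ->
  [/\ a + eps / 2 < pi / 2, forall z, z \in X w -> z != x -> dotp x z <= t &
    exists u, [/\ sphere u, dotp x u = 0 &
      forall z, z \in X w -> dotp u z <= k * (1 - dotp x z)]].
Proof.
move=> xX [[phiO _] pphi] [[[_ _ K2] eK] aK].
have e0 : 0 < eps by case/andP: eps01.
have [r2 uP] := direction_of_vartheta p1 phiO pphi (@Xsphere w) xX a_itv e0 aK
  K2 eK.
split => //.
exact: (far_of_inradius p1 phiO pphi (@Xsphere w) xX a_itv aK).
Qed.

(** No cell qualifies, by [deviation_geometry], so the upper bound is applied with an empty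
    family. *)
Lemma deviation_law_le0 : pi / 2 <= a + eps / 2 -> (law (deviation `&` large)
  <= 0)%E.
Proof.
move=> r2.
have := @typical_cell_law_le R d.+1 dO O P gamma X p kappa g0 PX kappaP 'I_0
  xpredT
  (fun=> set0) (fun=> set0) (fun=> measurable0) (fun=> measurable0) (fun=>
    setI0 _)
  (deviation `&` large).
rewrite big_ord0; apply => w x phi xX phix dev.
by have [] := deviation_geometry xX phix dev; rewrite ltNge r2.
Qed.

Lemma large_law_ge0 : (0 <= law large)%E.
Proof.
have := @typical_cell_law_ge R d.+1 dO O P gamma X p kappa g0 PX kappaP 'I_0
  xpredT
  (fun=> set0) (fun=> set0) (fun=> measurable0) (fun=> measurable0) (fun=>
    setI0 _) large.
by rewrite big_ord0; apply => [[]//|w x phi []].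
Qed.

Section partition.
Variables (beta delta : R) (I : finType) (A : I -> set (borel 'rV[R]_d.+2)).
Hypothesis r2 : a + eps / 2 < pi / 2.
Hypothesis gap : forall (x0 u0 xj : 'rV[R]_d.+2) (A : set (borel 'rV[R]_d.+2)),
    sphere x0 -> sphere u0 -> dotp x0 u0 = 0 -> measurable A ->
    (forall z, A z -> enorm (z - x0) <= delta) -> enorm (xj - x0) <= delta ->
    sph (A `|` cap_ge (t - delta) xj) + beta * Num.sqrt eps ^+ d.+2 <=
    sph (void_region t k delta x0 u0 `\` A).
Hypothesis mA : forall i, measurable (A i).
Hypothesis Adiam : forall i x y, A i x -> A i y -> enorm (x - y) <= delta.
Hypothesis Adisj : forall i j x, A i x -> A j x -> i = j.
Hypothesis Acover : forall x, sphere x -> exists i, A i x.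

(** The index [j] locates the nucleus and [i] the direction. [frame] picks one orthonormal pair; its
    default [(0, 0)] occurs only for pairs that are not [good]. *)
Let frames (ji : I * I) : set ('rV[R]_d.+2 * 'rV[R]_d.+2) :=
  [set xu | [/\ sphere xu.1, sphere xu.2, dotp xu.1 xu.2 = 0, A ji.1 xu.1 & A
    ji.2 xu.2]].
Let frame ji := xget (0, 0) (frames ji).
Let good ji := `[< frames ji !=set0 >].
Let centers j : set 'rV[R]_d.+2 := [set x | sphere x /\ A j x].
Let center j := xget 0 (centers j).
Let nonempty j := `[< centers j !=set0 >].

Let frameP ji : good ji -> frames ji (frame ji).
Proof. by move=> /asboolP[xu H]; exact: xgetPex (ex_intro _ xu H). Qed.

Let centerP j : nonempty j -> centers j (center j).
Proof. by move=> /asboolP[x H]; exact: xgetPex (ex_intro _ x H). Qed.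

Let k_ge0 : 0 <= k.
Proof.
have /andP[a0 _] := a_itv; have /andP[e0 _] := eps01; have pi0 := pi_gt0 R.
have r_lt := r2.
by apply: divr_ge0; [apply: cos_ge0_pihalf|apply: sin_ge0_pi]; apply/andP;
  split; lra.
Qed.

Let near_dotp j x y z : sphere z -> A j x -> A j y -> dotp x z <= dotp y z +
  delta.
Proof.
move=> z1 Ax Ay; rewrite -lerBlDl.
apply: le_trans (ler_norm _) _; apply: le_trans (normr_dotp_diff x y z1) _.
exact: Adiam Ax Ay.
Qed.

(** [A] is removed because the Poisson bounds need regions disjoint from the cell of the nucleus. *)
Let V ji := void_region t k delta (frame ji).1 (frame ji).2 `\` A ji.1.
Let C j := cap_ge (t - delta) (center j) `\` A j.

Let mV ji : measurable (V ji).
Proof. by apply: measurableD => //; exact: measurable_void_region. Qed.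

Let mC j : measurable (C j).
Proof. by apply: measurableD => //; exact: measurable_cap_ge. Qed.

Let bound := \sum_(j | nonempty j) sph (A j) * expR (- (gamma * sph (A j `|` C
  j))).

(** The nucleus and the direction differ from the chosen frame by at most [delta], which the slack
    in [void_region] absorbs. *)
Let deviation_law_le_sum : (law (deviation `&` large) <=
  (\sum_(ji | good ji) sph (A ji.1) * expR (- (gamma * sph (V ji))))%:E)%E.
Proof.
apply: (@typical_cell_law_le R d.+1 dO O P gamma X p kappa g0 PX kappaP
  (I * I)%type good (fun ji => A ji.1) V) => //.
  by move=> ji; apply/setDIK.
move=> w x phi xX phix dev.
have x1 : sphere x by exact: Xsphere xX.
have [_ far [u [u1 xu uX]]] := deviation_geometry xX phix dev.
have [j Aj] := Acover x1; have [i Ai] := Acover u1.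
have gji : good (j, i) by apply/asboolP; exists (x, u).
exists (j, i); split => //; apply/points_in_eq0 => z zX [zV zA].
have [_ _ _ /= Ax0 Au0] := frameP gji.
have z1 : sphere z by exact: Xsphere zX.
have zx : z != x by apply/eqP => zx; apply: zA; rewrite zx.
have xz := far z zX zx.
have H1 := near_dotp z1 Ax0 Aj; have H2 := near_dotp z1 Aj Ax0.
have H3 := near_dotp z1 Au0 Ai; have H4 := uX z zX.
case: zV => [H5|[_ H5]].
  have : t + delta < dotp (frame (j, i)).1 z by exact: H5.
  by lra.
have : k * (1 - dotp x z) <= k * (1 - (dotp (frame (j, i)).1 z - delta)).
  by apply: ler_wpM2l => //; lra.
by lra.
Qed.

(** The cap around [center j] with threshold [t - delta] contains every point that exceeds [t] for a
    nucleus in [A j]; inside [A j] the nucleus is alone. *)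
Let bound_le_large_law : (bound%:E <= law large)%E.
Proof.
apply: (@typical_cell_law_ge R d.+1 dO O P gamma X p kappa g0 PX kappaP I
  nonempty A C) => //.
  by move=> j; apply/setDIK.
move=> w x phi j _ xX Ax xuniq /points_in_eq0 XC [[phiO _] pphi].
apply: (inradius_ge p1 phiO pphi (@Xsphere w) xX a_itv) => z zX zx.
have x1 : sphere x by exact: Xsphere xX.
have z1 : sphere z by exact: Xsphere zX.
have [_ Ac] : centers j (center j) by apply: centerP; apply/asboolP; exists x.
rewrite leNgt; apply/negP => xz; apply: (XC z zX); split.
  have H : t - delta <= dotp (center j) z.
    by rewrite lerBlDr; apply: le_trans (near_dotp z1 Ax Ac); exact: ltW.
  exact: H.
by move=> /(xuniq z zX) zxE; move: zx; rewrite zxE eqxx.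
Qed.

(** By [gap], each numerator term [(j, i)] is at most [expR (- (L * gamma))] times the denominator
    term [j]; summing over the directions [i] yields the factor [#|I|], and the successor keeps the
    constant positive. *)
Lemma cond_prob_deviation_le : cond_prob law deviation large <=
  #|I|.+1%:R * expR (- (beta * Num.sqrt eps ^+ d.+2 * gamma)).
Proof.
set L := beta * _; set N := #|I|.
have term_ge0 j : 0 <= sph (A j) * expR (- (gamma * sph (A j `|` C j))).
  by apply: mulr_ge0; [exact: sph_ge0|exact: expR_ge0].
have bound0 : 0 <= bound by apply: sumr_ge0 => j _; exact: term_ge0.
apply: (fine_div_le deviation_law_le_sum bound_le_large_law) => //.
  by apply: sumr_ge0 => ji _; apply: mulr_ge0; [exact: sph_ge0|exact: expR_ge0].
apply: (@le_trans _ _ (\sum_(ji : I * I | nonempty ji.1 && true)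
    expR (- (L * gamma)) * (sph (A ji.1) * expR (- (gamma * sph (A ji.1 `|` C
      ji.1)))))).
  rewrite big_mkcond [leRHS]big_mkcond; apply: ler_sum => -[j i] _ /=.
  case: ifPn => gji; last first.
    by case: ifP => // _; apply: mulr_ge0 => //; exact: expR_ge0.
  have [x01 u01 xu Ax0 _] := frameP gji.
  have nj : nonempty j by apply/asboolP; exists (frame (j, i)).1.
  rewrite nj [leRHS]mulrCA; apply: ler_wpM2l; first exact: sph_ge0.
  rewrite -expRD ler_expR.
  have [_ Ac] := centerP nj.
  have := gap x01 u01 xu (mA j) (fun z Az => Adiam Az Ax0) (Adiam Ac Ax0).
  rewrite -/L (_ : A j `|` C j = A j `|` cap_ge (t - delta) (center j));
    last first.
    by apply/seteqP; split => z; rewrite /C /=; have [] := pselect (A j z); tauto.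
  rewrite -(ler_pM2l g0) => H.
  move: H; set q := sph (_ `|` _); set v := sph _ => H.
  rewrite (_ : - (L * gamma) - gamma * q = - (gamma * (q + L))); last by ring.
  by rewrite lerN2; exact: H.
rewrite -(pair_big_dep (fun j => nonempty j) (fun _ _ => true)
   (fun j _ => expR (- (L * gamma)) * (sph (A j) * expR (- (gamma * sph (A j
     `|` C j))))))/=.
under eq_bigr do rewrite sumr_const -/N -mulr_natl.
rewrite -mulr_sumr -mulr_sumr mulrA; apply: ler_wpM2r => //.
by apply: ler_wpM2r; [exact: expR_ge0|rewrite ler_nat].
Qed.

End partition.
End typical_cell_deviation.

Theorem theoremE (R : realType) (d : nat) (a : R) (hd : (2 <= d)%N)
    (ha : 0 < a < pi / 2) :
  exists2 beta : R, 0 < beta &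
  forall eps : R, 0 < eps <= 1 ->
  exists2 c : R, 0 < c &
  forall gamma : R, 0 < gamma ->
  forall (p : 'rV[R]_d.+1), sphere p ->
  forall (dO : measure_display) (O : measurableType dO) (P : probability O R)
    (X : O -> {fset 'rV[R]_d.+1})
    (kappa : R.-pker (borel 'rV[R]_d.+1) ~> (borel 'M[R]_d.+1)),
  isotropic_poisson_process P gamma X ->
  rotation_kernel p kappa ->
  cond_prob (typical_cell_law P gamma X kappa)
    [set K | convex_bodies_at p K /\ eps <= vartheta p K]
    [set K | a <= inradius p K]
  <= c * expR (- (beta * eps `^ (d.+1%:R / 2) * gamma)).
Proof.
case: d hd => [//|d] _.
have [beta beta0 gap] := exponent_gap d ha.
exists beta => // eps eps01.
have eps0 : 0 <= eps by case/andP: eps01 => /ltW.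
(* When [a + eps / 2] reaches [pi / 2] the numerator vanishes and any positive constant works. *)
have [r2|r2] := ltP (a + eps / 2) (pi / 2); last first.
  exists 1 => // gamma g0 p p1 dO O P X kappa PX kappaP.
  have num := deviation_law_le0 ha eps01 g0 p1 PX kappaP r2.
  have den := large_law_ge0 a g0 PX kappaP.
  by apply: (fine_div_le num den) => //; rewrite ?mulr0// mul1r expR_ge0.
have [delta delta0 {}gap] := gap eps eps01 r2.
have [I [A [mA Adiam Adisj Acover]]] := grid_partition d.+1 delta0.
exists #|I|.+1%:R => // gamma g0 p p1 dO O P X kappa PX kappaP.
rewrite powR_half_natr//.
exact: (cond_prob_deviation_le ha eps01 g0 p1 PX kappaP r2 gap mA Adiam Adisj
  Acover).
Qed.
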